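(* Let $S=\Bbbk[x_1,\dots,x_n]$ be a polynomial ring over a field $\Bbbk$ of characteristic zero, with the standard grading, and let $I\subseteq S$ be a homogeneous ideal with all generators of degree $r$. Let $N\ge 0$ be an integer for which there is an integer $k_0$ such that $\beta(I^k)\in B_{rk,\,rk+N}$ for every $k>k_0$. Then there exists an integer $K$ such that for every translated family of maximal chains $$\pi(\mathbf d^0(k))<\pi(\mathbf d^1(k))<\cdots<\pi(\mathbf d^l(k))\quad\text{in } B_{rk,\,rk+N}$$ (indexed by $k$) there are polynomials $w_0,\dots,w_l$ in one variable with rational coefficients such that, for all $k>K$, the Boij-S\''oderberg decomposition of $\beta(I^k)$ with respect to the maximal chain $\pi(\mathbf d^0(k))<\cdots<\pi(\mathbf d^l(k))$ is $$\beta(I^k)=w_0(k)\,\pi(\mathbf d^0(k))+\cdots+w_l(k)\,\pi(\mathbf d^l(k)).$$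
   Context: Betti diagrams. For a finitely generated graded $S$-module $M$, $\beta_{i,j}(M)=\dim_{\Bbbk}\operatorname{Tor}_i^S(M,\Bbbk)_j$ denotes the graded Betti numbers, and $\beta(M)=(\beta_{i,j}(M))_{i,j}$ is the Betti diagram (Betti table); $\beta_{i,i+j}(M)$ is displayed in column $i$ and row $j$. Here $\beta(I^k)$ is the Betti diagram of the ideal $I^k$ regarded as a graded $S$-module (not of $S/I^k$). Pure diagrams. For a strictly increasing sequence of integers $\mathbf d=(d_0,\dots,d_s)$ (a degree sequence), $\pi(\mathbf d)$ is the diagram with entries $$\pi(\mathbf d)_{i,j}=\prod_{p\neq i}\frac{1}{|d_p-d_i|}\ \text{ if } 0\le i\le s \text{ and } j=d_i,\qquad \pi(\mathbf d)_{i,j}=0\ \text{ otherwise}$$ (an empty product is $1$; the entry indexed by $(i,j)$ is in homological position $i$ and internal degree $j$). These are the pure diagrams. Partial order and chains. $\pi(d_0,\dots,d_s)\le\pi(d'_0,\dots,d'_t)$ if $s\ge t$ and $d_i\le d'_i$ for all $i=0,\dots,t$. A totally ordered set of pure diagrams is called a chain. The window $B_{M,N'}$. For integers $M\le N'$, $B_{M,N'}$ is the rational vector space of diagrams whose nonzero entries lie in columns $0,\dots,n$ and rows $M,\dots,N'$ (i.e. the entry at $(i,j)$ vanishes unless $0\le i\le n$ and $M+i\le j\le N'+i$). The pure diagrams in $B_{M,N'}$ are the $\pi(d_0,\dots,d_s)$ with $0\le s\le n$ and $M+i\le d_i\le N'+i$ for all $i$. A maximal chain in $B_{M,N'}$ is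 a chain of pure diagrams in $B_{M,N'}$ that is maximal under inclusion among such chains. Every maximal chain in $B_{M,N'}$ is a basis of $B_{M,N'}$ (Boij-S\''oderberg), so every $\beta\in B_{M,N'}$ has a unique expression as a linear combination, with not necessarily positive rational coefficients, of the members of the chain; this expression is the (Boij-S\''oderberg) decomposition of $\beta$ with respect to the maximal chain. Translated families. A translated family of pure diagrams (indexed by $k$) is a sequence of pure diagrams $\pi(k)$ whose nonzero positions have a fixed shape beginning in a row given by a linear function of $k$; that is, there are a fixed degree sequence $(d_0,\dots,d_p)$ and a linear function $h(k)=ak+b$ with integer coefficients such that $\pi(k)=\pi(d_0+h(k),\dots,d_p+h(k))$ for all $k$. A translated family of maximal chains in $B_{rk,rk+N}$ is a collection of chains $\{\pi_0(k)<\pi_1(k)<\cdots<\pi_l(k)\}$, indexed by $k$, such that each $\pi_i(k)$ is a translated family of pure diagrams and, for each $k$, the $k$-th chain is a maximal chain in $B_{rk,rk+N}$. *)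

(* Defs.v *)
From Stdlib Require Import ClassicalEpsilon.
From mathcomp Require Import all_boot all_order all_algebra.
From mathcomp Require Export mpoly.

Set Implicit Arguments.
Unset Strict Implicit.
Unset Printing Implicit Defensive.

Import Order.TTheory GRing.Theory Num.Theory.
Local Open Scope ring_scope.

(* Ideals are [Prop]-valued predicates: [idealr_closed] of MathComp only
   covers decidable proper ideals, while the zero and unit ideals are both
   allowed here. *)

Definition ideal_span (A : comNzRingType) (gs : seq A) (p : A) : Prop :=
  exists c : 'I_(size gs) -> A, p = \sum_(i < size gs) c i * gs`_i.

Definition ideal_mul (A : comNzRingType) (I J : A -> Prop) (p : A) : Prop :=
  exists s : seq (A * A),
    (forall q, q \in s -> I q.1 /\ J q.2) /\ p = \sum_(q <- s) q.1 * q.2.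

Fixpoint ideal_exp (A : comNzRingType) (I : A -> Prop) (k : nat) : A -> Prop :=
  if k is k'.+1 then ideal_mul (ideal_exp I k') I else fun=> True.

Definition generated_in_degree (F : fieldType) (n r : nat)
    (I : {mpoly F[n]} -> Prop) : Prop :=
  exists gs : seq {mpoly F[n]},
    (forall g, g \in gs -> g \is r.-homog) /\
    (forall p, I p <-> ideal_span gs p).

(* Every monomial of [p] has degree [e]; since [e] may be negative, this
   forces [p = 0] in that case. *)
Definition homog_of_degree (F : fieldType) (n : nat) (e : int)
    (p : {mpoly F[n]}) : Prop :=
  forall m, m \in msupp p -> (mdeg m)%:Z = e.

(* A graded resolution  ... -> F_1 -> F_0 -> J -> 0  of an ideal J of
   S = F[x_1..x_n], with F_i the direct sum of the S(- gdeg i a),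
   a < grank i. Elements of F_i are row vectors and maps act by right
   multiplication, so the a-th generator of F_(i+1) goes to row a of
   [gdiff i]; the homogeneity conditions say that all maps have degree 0. *)
Record graded_free_resolution (F : fieldType) (n : nat)
    (J : {mpoly F[n]} -> Prop) := GradedFreeResolution {
  grank : nat -> nat;
  gdeg : forall i : nat, 'I_(grank i) -> int;
  gdiff : forall i, 'M[{mpoly F[n]}]_(grank i.+1, grank i);
  gaug : 'cV[{mpoly F[n]}]_(grank 0);
  gaug_homog : forall a : 'I_(grank 0), homog_of_degree (gdeg a) (gaug a 0);
  gdiff_homog : forall i (a : 'I_(grank i.+1)) (b : 'I_(grank i)),
    homog_of_degree (gdeg a - gdeg b) (gdiff i a b);
  gaug_onto : forall p, J p <-> exists u : 'rV_(grank 0), p = (u *m gaug) 0 0;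
  gexact0 : forall u : 'rV_(grank 0),
    u *m gaug = 0 <-> exists v : 'rV_(grank 1), u = v *m gdiff 0;
  gexactS : forall i (u : 'rV_(grank i.+1)),
    u *m gdiff i = 0 <-> exists v : 'rV_(grank i.+2), u = v *m gdiff i.+1
}.

Section Tor.

Variables (F : fieldType) (n : nat) (J : {mpoly F[n]} -> Prop).
Variable R : graded_free_resolution J.

(* The differential of the resolution tensored with the residue field
   F = S/(x_1..x_n): each entry is replaced by its constant coefficient. *)
Definition tor_diff (i : nat) : 'M[F]_(grank R i.+1, grank R i) :=
  map_mx (fun p : {mpoly F[n]} => p@_(0%MM)) (gdiff R i).

(* Matrix whose row space is the degree j part of F_i (x) F. *)
Definition tor_strand (i : nat) (j : int) : 'M[F]_(grank R i) :=
  diag_mx (\row_a (gdeg a == j)%:R).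

Definition tor_cycles (i : nat) (j : int) : 'M[F]_(grank R i) :=
  match i return 'M[F]_(grank R i) with
  | 0 => tor_strand 0 j
  | i'.+1 => (tor_strand i'.+1 j :&: kermx (tor_diff i'))%MS
  end.

Definition tor_boundaries (i : nat) (j : int) : 'M[F]_(_, grank R i) :=
  tor_strand i.+1 j *m tor_diff i.

(* Boundaries are contained in cycles, so this is the dimension of the
   homology, i.e. of Tor_i(J, F)_j. *)
Definition tor_dim (i : nat) (j : int) : nat :=
  (\rank (tor_cycles i j) - \rank (tor_boundaries i j))%N.

End Tor.

(* The common value of [tor_dim R i j] over all graded free resolutions [R]
   of [J] (which exist for homogeneous [J], as S is noetherian). *)
Definition betti (F : fieldType) (n : nat) (J : {mpoly F[n]} -> Prop)
    (i : nat) (j : int) : nat :=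
  epsilon (inhabits 0%N)
    (fun b => exists R : graded_free_resolution J, b = tor_dim R i j).

(* Homological position first, internal degree second. *)
Definition diagram := nat -> int -> rat.

Definition betti_diagram (F : fieldType) (n : nat)
    (J : {mpoly F[n]} -> Prop) : diagram :=
  fun i j => (betti J i j)%:R.

Definition in_window (n : nat) (M N' : int) (B : diagram) : Prop :=
  forall i j, B i j != 0 -> (i <= n)%N /\ M + i%:Z <= j <= N' + i%:Z.

Definition degree_sequence (d : seq int) : Prop :=
  (0 < size d)%N /\
  forall i j, (i < j)%N -> (j < size d)%N -> d`_i < d`_j.

Definition pure_diagram (d : seq int) : diagram := fun i j =>
  if (i < size d)%N && (j == d`_i)
  then \prod_(p < size d | (p : nat) != i) (`|d`_p - d`_i|%:~R)^-1
  else 0.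

Lemma pure_diagram_neq0 d i j : degree_sequence d ->
  (pure_diagram d i j != 0) = (i < size d)%N && (j == d`_i).
Proof.
move=> [_ dlt]; rewrite /pure_diagram; case: ifP => [/andP[id _]|]; last first.
  by rewrite eqxx.
apply/prodf_neq0 => p pi; rewrite invr_eq0 intr_eq0 normr_eq0 subr_eq0.
move: pi; rewrite neq_ltn => /orP[pi|ip].
- by rewrite lt_eqF // dlt.
- by rewrite gt_eqF // dlt.
Qed.

(* Hence pure diagrams, their order and chains of them can be handled
   through their degree sequences. *)
Lemma pure_diagram_inj d d' : degree_sequence d -> degree_sequence d' ->
  (forall i j, pure_diagram d i j = pure_diagram d' i j) -> d = d'.
Proof.
move=> hd hd' e.
have E i j : (i < size d)%N && (j == d`_i) = (i < size d')%N && (j == d'`_i).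
  by rewrite -!pure_diagram_neq0 // e.
have sz i : (i < size d)%N = (i < size d')%N.
  apply/idP/idP => h.
  - by have := E i d`_i; rewrite h eqxx => /esym/andP[].
  - by have := E i d'`_i; rewrite h eqxx => /andP[].
have szE : size d = size d'.
  by apply/eqP; rewrite eqn_leq [(size d <= _)%N]leqNgt [(size d' <= _)%N]leqNgt
    -sz ltnn sz ltnn.
apply: (@eq_from_nth _ 0) => // i id.
by have := E i d`_i; rewrite id eqxx => /esym/andP[_ /eqP].
Qed.

Definition pure_le (d d' : seq int) : Prop :=
  (size d' <= size d)%N /\ forall i, (i < size d')%N -> d`_i <= d'`_i.

Definition pure_lt (d d' : seq int) : Prop := pure_le d d' /\ d <> d'.

Definition pure_in_window (n : nat) (M N' : int) (d : seq int) : Prop :=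
  [/\ degree_sequence d, (size d <= n.+1)%N
    & forall i, (i < size d)%N -> M + i%:Z <= d`_i <= N' + i%:Z].

Definition pure_chain (n : nat) (M N' : int) (C : seq int -> Prop) : Prop :=
  (forall d, C d -> pure_in_window n M N' d) /\
  (forall d d', C d -> C d' -> pure_le d d' \/ pure_le d' d).

Definition maximal_pure_chain (n : nat) (M N' : int) (C : seq int -> Prop) :
    Prop :=
  pure_chain n M N' C /\
  forall C' : seq int -> Prop, pure_chain n M N' C' ->
    (forall d, C d -> C' d) -> forall d, C' d -> C d.

Definition translated_pure (d : nat -> seq int) : Prop :=
  exists (d0 : seq int) (a b : int), degree_sequence d0 /\
    forall k : nat, d k = [seq x + (a * k%:Z + b) | x <- d0].

Definition translated_maximal_chains (n r N l : nat)
    (d : 'I_l.+1 -> nat -> seq int) : Prop :=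
  (forall m, translated_pure (d m)) /\
  forall k : nat,
    (forall m m' : 'I_l.+1, (m < m')%N -> pure_lt (d m k) (d m' k)) /\
    maximal_pure_chain n (r * k)%N%:Z (r * k + N)%N%:Z
      (fun e => exists m, e = d m k).

(* Maximal chains are bases of the space of diagrams in the window, so at
   most one family [c] satisfies this when [d] lists a maximal chain. *)
Definition boij_soderberg_decomposition (l : nat) (d : 'I_l.+1 -> seq int)
    (c : 'I_l.+1 -> rat) (B : diagram) : Prop :=
  forall i j, B i j = \sum_(m < l.+1) c m * pure_diagram (d m) i j.

(* Main.v *)
From HB Require Import structures.
From Stdlib Require Import ClassicalEpsilon.
Require Import Defs.
From mathcomp Require Import all_boot all_order all_algebra.
From mathcomp Require Import mpoly.
From mathcomp Require Import ring zify.

(** Betti numbers are computed on the Koszul complex with coefficients in the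
    ideal ([tor_dim_koszul]). This uses no comparison of resolutions: the iterated
    connecting homomorphisms between a resolution and the Koszul complex are
    handled as linear correspondences ([qdim_correspondence]), and the Koszul
    complex of a free module is exact because, in characteristic zero, the de Rham
    differential is a contracting homotopy up to the total degree
    ([koszul_homotopy], [koszul_exact]). A finite free resolution of every power
    exists by noetherianity, so the numbers in question are really Betti numbers
    ([power_resolution_exists]).

    Let [g_1 .. g_m] generate [I] in degree [r]. For fixed [h] and [j], the Koszul
    chains of [I^k] at position [h] and internal degree [r k + j], taken for all
    [k] together, are generated over the polynomial ring in [m] variables that act
    as the [g_i] by finitely many elements at [k = 0]; so are their images under
    the Koszul differential. The dimension of the part of degree [k] of such a
    module is the number of irreducible monomials of degree [k], which form
    down-sets, so by Dickson's lemma it is a polynomial in [k] for large [k]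
    ([degree_part_hilbert_polynomial]). A Betti number is the dimension of a space
    of chains minus those of two images, hence it is eventually polynomial too
    ([betti_eventually_polynomial]); this is Kodiyalam's theorem. Only finitely
    many pairs [(h, j)] occur in the window, which gives a bound on [k] that does
    not depend on any chain.

    On the combinatorial side, a translated family of maximal chains moves with
    slope [r] exactly ([translated_pure_slope]), so it is one maximal chain at
    [k = 0], translated by [r k]. In a maximal chain every position of the window
    is covered ([position_covered]), and each step leaves a single position
    ([one_position_lost]); the pure diagrams are thus triangular with respect to
    the positions and span all diagrams in the window ([unit_diagram_in_span]).
    The coefficients of the decomposition are therefore fixed rational
    combinations of the entries of the Betti diagram, hence polynomials in [k]. *)

Set Implicit Arguments.
Unset Strict Implicit.
Unset Printing Implicit Defensive.

Import Order.TTheory GRing.Theory Num.Theory.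
Local Open Scope ring_scope.

(** * Dimensions of subquotients *)

Section Subquotients.

Variables (F : fieldType) (A : nzRingType) (iota : {rmorphism F -> A}).

(** Modules over a ring [A] are regarded as vector spaces over a field [F]
    through a morphism [iota], so that multiplication by elements of [A] and
    dimensions over [F] live on the same type. *)
Definition subspace (V : lmodType A) (W : V -> Prop) : Prop :=
  W 0 /\ forall c u v, W u -> W v -> W (iota c *: u + v).

Definition lincomb (V : lmodType A) d (c : 'I_d -> F) (b : 'I_d -> V) : V :=
  \sum_i iota (c i) *: b i.

(** The quotient of [W] by [B] has a basis of [d] elements;
  the basis is given by
    representatives, and the quotient is never formed. *)
Definition qdim (V : lmodType A) (W B : V -> Prop) (d : nat) : Prop :=
  exists b : 'I_d -> V,
    [/\ forall i, W (b i),
        forall w, W w -> exists c, B (w - lincomb c b)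
      & forall c, B (lincomb c b) -> forall i, c i = 0].

Section OneSpace.

Variable V : lmodType A.
Implicit Types (W B D : V -> Prop).

Lemma subspaceZ W c u : subspace W -> W u -> W (iota c *: u).
Proof. by case=> W0 Wl Wu; rewrite -[_ *: _]addr0; apply: Wl. Qed.

Lemma subspaceD W u v : subspace W -> W u -> W v -> W (u + v).
Proof.
by case=> W0 Wl Wu Wv; rewrite -[u]scale1r -(rmorph1 iota); apply: Wl.
Qed.

Lemma subspaceN W u : subspace W -> W u -> W (- u).
Proof.
by move=> sW Wu; rewrite -scaleN1r -(rmorphN1 iota); apply: subspaceZ.
Qed.

Lemma subspaceB W u v : subspace W -> W u -> W v -> W (u - v).
Proof. by move=> sW Wu Wv; apply: subspaceD => //; apply: subspaceN. Qed.

Lemma subspace_sum W (I : Type) (s : seq I) (P : pred I) (f : I -> V) :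
  subspace W -> (forall i, P i -> W (f i)) -> W (\sum_(i <- s | P i) f i).
Proof.
move=> sW Wf; elim/big_ind: _ => //; first by case: sW.
by move=> u v; apply: subspaceD.
Qed.

Lemma subspace_lincomb W d (c : 'I_d -> F) (b : 'I_d -> V) :
  subspace W -> (forall i, W (b i)) -> W (lincomb c b).
Proof. by move=> sW Wb; apply: subspace_sum => // i _; apply: subspaceZ. Qed.

Lemma subspace0 : subspace (fun v : V => v = 0).
Proof. by split=> // c u v -> ->; rewrite scaler0 addr0. Qed.

(** More than [d'] vectors of [W] satisfy a relation modulo [B]: their
    coordinates form a matrix with more rows than columns. *)
Lemma qdim_leq W B d d' : subspace B -> qdim W B d -> qdim W B d' -> (d <=
  d')%N.
Proof.
move=> sB [b [Wb _ bfree]] [b' [_ b'gen _]].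
have [C CP] : exists C : 'I_d -> 'I_d' -> F,
    forall i, B (b i - lincomb (C i) b').
  by apply: (@fin_all_exists _ _ (fun i c => B (b i - lincomb c b'))) => i;
    apply: b'gen.
pose M := \matrix_(i < d, j < d') C i j.
suff /eqP <- : row_free M by apply: rank_leq_col.
rewrite -kermx_eq0; apply/eqP/row_matrixP => k; rewrite row0.
set u := row k _.
have uM : u *m M = 0 by apply/sub_kermxP; apply: row_sub.
suff B0 : B (lincomb (fun i => u 0 i) b).
  by apply/rowP => i; rewrite (bfree _ B0 i) mxE.
suff -> : lincomb (fun i => u 0 i) b
    = \sum_i iota (u 0 i) *: (b i - lincomb (C i) b').
  by apply: subspace_sum => // i _; apply: subspaceZ.
under [RHS]eq_bigr do rewrite scalerBr.
rewrite sumrB -[LHS]subr0; congr (_ - _).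
transitivity (lincomb (fun j => (u *m M) 0 j) b').
  by rewrite uM /lincomb big1 // => j _; rewrite mxE rmorph0 scale0r.
under [RHS]eq_bigr do rewrite scaler_sumr.
rewrite exchange_big; apply: eq_bigr => j _; rewrite mxE rmorph_sum scaler_suml.
by apply: eq_bigr => i _; rewrite !mxE rmorphM scalerA.
Qed.

Lemma qdim_uniq W B d d' : subspace B -> qdim W B d -> qdim W B d' -> d = d'.
Proof.
move=> sB h h'; apply/eqP; rewrite eqn_leq.
by rewrite (qdim_leq sB h h') (qdim_leq sB h' h).
Qed.

(** A basis of [B] modulo [D] together with representatives of a basis of [W]
    modulo [B] is a basis of [W] modulo [D]. *)
Lemma qdimD W B D b e : (forall v, D v -> B v) -> (forall v, B v -> W v) ->
  subspace B -> qdim B D b -> qdim W B e -> qdim W D (b + e).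
Proof.
move=> DB BW sB [x [Bx xgen xfree]] [y [Wy ygen yfree]].
pose z i := match split i with inl i => x i | inr j => y j end.
have zE c : lincomb c z
    = lincomb (fun i => c (lshift e i)) x + lincomb (fun j => c (rshift b j)) y.
  rewrite /lincomb big_split_ord; congr (_ + _); apply: eq_bigr => i _.
    by rewrite /z (unsplitK (inl i)).
  by rewrite /z (unsplitK (inr i)).
exists z; split.
- by move=> i; rewrite /z; case: (split i) => j //; apply: BW.
- move=> w /ygen[cy /xgen[cx Dc]].
  exists (fun i => match split i with inl i => cx i | inr j => cy j end).
  rewrite zE opprD [- _ - _]addrC addrA; congr (D (_ - _ - _)): Dc.
    by apply: eq_bigr => i _; rewrite (unsplitK (inr i)).
  by apply: eq_bigr => i _; rewrite (unsplitK (inl i)).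
- move=> c; rewrite zE => Dc.
  have cy : forall j, c (rshift b j) = 0.
    apply: yfree; rewrite -[lincomb _ y](addKr (lincomb (c \o lshift e) x)).
    apply: subspaceD => //; last exact: DB.
    by apply: subspaceN => //; apply: subspace_lincomb.
  have cx : forall i, c (lshift e i) = 0.
    apply: xfree; congr D: Dc; rewrite [X in _ + X]big1 ?addr0 // => j _.
    by rewrite cy rmorph0 scale0r.
  by move=> i; rewrite -(splitK i); case: (split i).
Qed.

Lemma qdim_ext W W' B B' d : (forall v, W v <-> W' v) ->
  (forall v, W v -> B v <-> B' v) -> subspace W ->
  qdim W B d -> qdim W' B' d.
Proof.
move=> WW' BB' sW [b [Wb bgen bfree]]; exists b; split.
- by move=> i; apply/WW'.
- move=> w /WW' Ww; have [c Bc] := bgen w Ww; exists c; apply/BB' => //.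
  by apply: subspaceB => //; apply: subspace_lincomb.
- by move=> c B'c; apply: bfree; apply/BB' => //; apply: subspace_lincomb.
Qed.

End OneSpace.

(** Connecting homomorphisms are used below in the form of linear
    correspondences [G]: total on both sides and compatible with the subspaces
    divided out, such a [G] induces an isomorphism of subquotients, and no
    choice of representatives has to be shown irrelevant. *)
Lemma qdim_correspondence (V V' : lmodType A) (W B : V -> Prop)
    (W' B' : V' -> Prop) (G : V -> V' -> Prop) d :
  subspace W -> subspace W' ->
  G 0 0 ->
  (forall c u u' v v', G u u' -> G v v' ->
     G (iota c *: u + v) (iota c *: u' + v')) ->
  (forall w, W w -> exists2 w', W' w' & G w w') ->
  (forall w', W' w' -> exists2 w, W w & G w w') ->
  (forall w w', W w -> W' w' -> G w w' -> B w <-> B' w') ->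
  qdim W B d -> qdim W' B' d.
Proof.
move=> sW sW' G0 Gl Gr Gr' GB [b [Wb bgen bfree]].
have [b' b'P] : exists b' : 'I_d -> V', forall i, W' (b' i) /\ G (b i) (b' i).
  apply: (@fin_all_exists _ _ (fun i x => W' x /\ G (b i) x)) => i.
  by have [x] := Gr _ (Wb i); exists x.
have W'b' i : W' (b' i) by case: (b'P i).
have Gc c : G (lincomb c b) (lincomb c b').
  rewrite /lincomb; elim: (index_enum _) => [|i s ih].
    by rewrite !big_nil.
  by rewrite !big_cons; apply: Gl => //; case: (b'P i).
exists b'; split => //.
- move=> w' Ww'; have [w Ww Gw] := Gr' _ Ww'; have [c Bc] := bgen _ Ww.
  exists c; apply/(GB (w - lincomb c b)) => //.
  + by apply: subspaceB => //; apply: subspace_lincomb.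
  + by apply: subspaceB => //; apply: subspace_lincomb.
  + rewrite [w - _]addrC [w' - _]addrC -scaleN1r -[- lincomb c b']scaleN1r.
    by rewrite -(rmorphN1 iota); apply: Gl.
- move=> c B'c; apply: bfree; apply/(GB _ (lincomb c b')) => //.
  + by apply: subspace_lincomb.
  + by apply: subspace_lincomb.
Qed.

End Subquotients.

Section Spans.

Variables (R A : nzRingType) (iota : {rmorphism R -> A}) (V : lmodType A).

(** Taking a field for [R] gives the linear span over that field, and taking
    [R := A] with the identity gives the submodule generated by [X]. *)
Inductive span (X : V -> Prop) : V -> Prop :=
| span_nil : span X 0
| span_cons c x v : X x -> span X v -> span X (iota c *: x + v).

Lemma span_in (X : V -> Prop) x : X x -> span X x.
Proof.
move=> Xx; rewrite -[x]scale1r -(rmorph1 iota) -[X in span _ X]addr0.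
exact/span_cons/span_nil.
Qed.

Lemma spanD (X : V -> Prop) u v : span X u -> span X v -> span X (u + v).
Proof.
move=> Xu Xv; elim: Xu => [|c x w Xx _ ih]; first by rewrite add0r.
by rewrite -addrA; apply: span_cons.
Qed.

Lemma spanZ (X : V -> Prop) c u : span X u -> span X (iota c *: u).
Proof.
elim=> [|c' x w Xx _ ih]; first by rewrite scaler0; apply: span_nil.
by rewrite scalerDr scalerA -rmorphM; apply: span_cons.
Qed.

Lemma span_min (X Y : V -> Prop) : Y 0 ->
  (forall u v, Y u -> Y v -> Y (u + v)) ->
  (forall c u, X u -> Y (iota c *: u)) -> forall v, span X v -> Y v.
Proof. by move=> Y0 YD YX v; elim=> // c x w Xx _ Yw; apply/YD/Yw/YX. Qed.

Lemma span_span (X Y : V -> Prop) : (forall v, X v -> span Y v) ->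
  forall v, span X v -> span Y v.
Proof.
move=> XY v; apply: span_min; first exact: span_nil.
  by move=> u w; apply: spanD.
by move=> c u Xu; apply/spanZ/XY.
Qed.

Lemma span_sum (X : V -> Prop) (I : Type) (s : seq I) (P : pred I)
    (f : I -> V) :
  (forall i, P i -> span X (f i)) -> span X (\sum_(i <- s | P i) f i).
Proof.
move=> Xf; elim/big_ind: _ => //; first exact: span_nil.
by move=> u v; apply: spanD.
Qed.

End Spans.

Lemma subspace_span (F : fieldType) (A : nzRingType)
    (iota : {rmorphism F -> A}) (V : lmodType A) (X : V -> Prop) :
  subspace iota (span iota X).
Proof.
split=> [|c u v Xu Xv]; first exact: span_nil.
by apply: spanD => //; apply: spanZ.
Qed.

(** * Dickson's lemma *)

(** Up-sets of tuples satisfy the ascending chain condition. The slices of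
    [U s] at first coordinate [t] increase with both [s] and [t]; by induction
    the diagonal slices are constant from some [s0] on, and this bounds all
    slices with [t >= s0], while the remaining ones are finitely many chains. *)
Lemma upset_chain_stable m (U : nat -> m.-tuple nat -> Prop) :
  (forall s a b, (forall i, (tnth a i <= tnth b i)%N) -> U s a -> U s b) ->
  (forall s a, U s a -> U s.+1 a) ->
  exists s0, forall s a, U s a -> U s0 a.
Proof.
elim: m U => [|m ih] U up inc.
  have [[s Us]|noU] := Classical_Prop.classic (exists s, U s [tuple]).
    by exists s => s' a _; rewrite tuple0.
  by exists 0%N => s a; rewrite tuple0 => Us; case: noU; exists s.
have mono s s' a : (s <= s')%N -> U s a -> U s' a.
  move=> /subnK <-; elim: (s' - s)%N => // j ihj Us.
  by rewrite addSn; apply/inc/ihj.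
have upt s t t' (b : m.-tuple nat) : (t <= t')%N ->
    U s [tuple of t :: b] -> U s [tuple of t' :: b].
  move=> tt'; apply: up => i; case: (unliftP ord0 i) => [j ->|->] //.
  by rewrite !tnthS.
have upb s t (a b : m.-tuple nat) : (forall i, (tnth a i <= tnth b i)%N) ->
    U s [tuple of t :: a] -> U s [tuple of t :: b].
  move=> ab; apply: up => i; case: (unliftP ord0 i) => [j ->|->] //.
  by rewrite !tnthS.
have [s0 s0P] : exists s0, forall s (b : m.-tuple nat),
    U s [tuple of s :: b] -> U s0 [tuple of s0 :: b].
  apply: (ih (fun s (b : m.-tuple nat) => U s [tuple of s :: b])) => s b;
    first exact: upb.
  by move=> Us; apply: (upt _ s) => //; apply: inc.
have [S SP] : exists S, forall t, (t < s0)%N -> forall s (b : m.-tuple nat),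
    U s [tuple of t :: b] -> U S [tuple of t :: b].
  elim: (s0) => [|T [S SP]]; first by exists 0%N.
  have [S' S'P] := ih (fun s (b : m.-tuple nat) => U s [tuple of T :: b])
    (fun s => upb s T) (fun s b => inc s _).
  exists (maxn S S') => t; rewrite ltnS leq_eqVlt => /predU1P[->|tT] s b Us.
    exact/(mono S')/(S'P s)/Us/leq_maxr.
  exact/(mono S)/(SP t tT s)/Us/leq_maxl.
exists (maxn s0 S) => s a; case: (tupleP a) => t b Us.
have [ts0|s0t] := ltnP t s0.
  exact/(mono S)/(SP t ts0 s)/Us/leq_maxr.
apply/(mono s0)/(upt _ s0) => //; first exact: leq_maxl.
apply: (s0P (maxn s t)); apply: (upt _ t); first exact: leq_maxr.
exact/(mono s)/Us/leq_maxl.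
Qed.

Lemma monomial_upset_chain_stable m (U : nat -> 'X_{1..m} -> Prop) :
  (forall s a b, U s a -> U s (a + b)%MM) ->
  (forall s a, U s a -> U s.+1 a) ->
  exists s0, forall s a, U s a -> U s0 a.
Proof.
move=> up inc.
have [||s0 s0P] := @upset_chain_stable m (fun s a => U s (Multinom a)).
- move=> s a b ab Us; have /submK <- : (Multinom a <= Multinom b)%MM.
    by apply/mnm_lepP.
  by rewrite addmC; apply: up.
- by move=> s a; apply: inc.
by exists s0 => s [a] /s0P.
Qed.

(** * Eventually polynomial functions *)

Definition eventually_polynomial (f : nat -> rat) : Prop :=
  exists P : {poly rat}, exists K, forall k, (K <= k)%N -> f k = P.[k%:R].

Lemma eventually_polynomial_ext f g K :
  (forall k, (K <= k)%N -> f k = g k) ->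
  eventually_polynomial f -> eventually_polynomial g.
Proof.
move=> fg [P [K' PK]]; exists P, (maxn K K') => k; rewrite geq_max.
by case/andP=> Kk K'k; rewrite -fg // PK.
Qed.

Lemma eventually_polynomial_const c : eventually_polynomial (fun=> c).
Proof. by exists c%:P, 0%N => k _; rewrite hornerC. Qed.

Lemma eventually_polynomialD f g : eventually_polynomial f ->
  eventually_polynomial g -> eventually_polynomial (fun k => f k + g k).
Proof.
move=> [P [K PK]] [Q [K' QK]]; exists (P + Q), (maxn K K') => k.
by rewrite geq_max => /andP[Kk K'k]; rewrite hornerD PK ?QK.
Qed.

Lemma eventually_polynomialZ c f : eventually_polynomial f ->
  eventually_polynomial (fun k => c * f k).
Proof.
by move=> [P [K PK]]; exists (c *: P), K => k Kk; rewrite hornerZ PK.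
Qed.

Lemma eventually_polynomial_sum (I : Type) (s : seq I) (f : I -> nat -> rat) :
  (forall i, eventually_polynomial (f i)) ->
  eventually_polynomial (fun k => \sum_(i <- s) f i k).
Proof.
move=> fP; elim: s => [|i s ih].
  apply: (@eventually_polynomial_ext (fun=> 0) _ 0) => [k _|].
    by rewrite big_nil.
  exact: eventually_polynomial_const.
apply: (@eventually_polynomial_ext (fun k => f i k + \sum_(i <- s) f i k) _ 0).
  by move=> k _; rewrite big_cons.
exact: eventually_polynomialD.
Qed.

Lemma eventually_polynomial_shift f a b : eventually_polynomial f ->
  eventually_polynomial (fun k => f (k + a - b)%N).
Proof.
move=> [P [K PK]]; exists (P \Po ('X + (a%:R - b%:R)%:P)), (K + b)%N => k Kk.
rewrite horner_comp hornerD hornerX hornerC PK; last by lia.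
by rewrite natrB ?natrD ?addrA //; lia.
Qed.

(** The sum of [(s + 1) ^ d.+1 - s ^ d.+1] telescopes, and expanding it by the
    binomial formula expresses the sum of the [d]-th powers through those of
    lower exponents. *)
Lemma sum_powers_polynomial d :
  exists Q : {poly rat}, forall k, \sum_(s < k) s%:R ^+ d = Q.[k%:R].
Proof.
elim/ltn_ind: d => d ih.
have [q qP] : exists q : 'I_d -> {poly rat},
    forall (t : 'I_d) k, \sum_(s < k) s%:R ^+ t = (q t).[k%:R].
  apply: (@fin_all_exists _ _ (fun (t : 'I_d) (Q : {poly rat}) =>
    forall k, \sum_(s < k) s%:R ^+ t = Q.[k%:R])) => t.
  exact: ih.
exists (d.+1%:R^-1 *: ('X^(d.+1) - \sum_(t < d) 'C(d.+1, t)%:R *: q t)) => k.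
rewrite hornerZ hornerD hornerN hornerXn horner_sum.
rewrite (eq_bigr (fun t : 'I_d => 'C(d.+1, t)%:R * \sum_(s < k) s%:R ^+ t));
  last by move=> t _; rewrite hornerZ -qP.
have d0 : d.+1%:R != 0 :> rat by rewrite pnatr_eq0.
have tele : k%:R ^+ d.+1
    = \sum_(s < k) \sum_(t < d.+1) s%:R ^+ t *+ 'C(d.+1, t) :> rat.
  elim: k => [|k ihk]; first by rewrite big_ord0 expr0n.
  rewrite big_ord_recr /= -ihk -addn1 natrD [_ + 1%:R]addrC.
  rewrite exprDn big_ord_recr /=.
  rewrite subnn binn expr0 mul1r mulr1n [LHS]addrC; congr (_ + _).
  by apply: eq_bigr => t _; rewrite expr1n mul1r.
rewrite tele exchange_big /= big_ord_recr /= binSn addrAC -sumrB.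
rewrite [X in _ * (X + _)]big1 ?add0r => [|t _].
  by rewrite sumrMnl -[X in _ * X]mulr_natl mulKf.
by rewrite mulr_natl sumrMnl subrr.
Qed.

Lemma sum_horner_polynomial (P : {poly rat}) :
  exists Q : {poly rat}, forall k, \sum_(s < k) P.[s%:R] = Q.[k%:R].
Proof.
have [q qP] : exists q : 'I_(size P) -> {poly rat},
    forall (t : 'I_(size P)) k, \sum_(s < k) s%:R ^+ t = (q t).[k%:R].
  apply: (@fin_all_exists _ _ (fun (t : 'I_(size P)) (Q : {poly rat}) =>
    forall k, \sum_(s < k) s%:R ^+ t = Q.[k%:R])) => t.
  exact: sum_powers_polynomial.
exists (\sum_(t < size P) P`_t *: q t) => k; rewrite horner_sum.
under eq_bigr do rewrite horner_coef.
by rewrite exchange_big; apply: eq_bigr => t _; rewrite -mulr_sumr hornerZ qP.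
Qed.

Lemma eventually_polynomial_partial_sums f : eventually_polynomial f ->
  eventually_polynomial (fun k => \sum_(s < k) f s).
Proof.
move=> [P [K PK]]; have [Q QP] := sum_horner_polynomial P.
exists (Q + (\sum_(s < K) f s - Q.[K%:R])%:P), K => k Kk.
rewrite hornerD hornerC -!QP -!(big_mkord xpredT f).
rewrite -!(big_mkord xpredT (fun s => P.[s%:R])).
rewrite (big_cat_nat (leq0n K) Kk) //= (big_cat_nat (F := fun s => P.[s%:R])
  (leq0n K) Kk) //=.
rewrite (@eq_big_nat _ _ _ K k f (fun s => P.[s%:R])); last first.
  by move=> s /andP[Ks _]; apply: PK.
by ring.
Qed.

(** * Counting the monomials of a down-set *)

Fixpoint compositions m (k : nat) : seq (m.-tuple nat) :=
  match m return seq (m.-tuple nat) with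
  | 0 => if k == 0%N then [:: [tuple]] else [::]
  | m'.+1 =>
      [seq [tuple of (t : nat) :: (b : m'.-tuple nat)]
         | t <- iota 0 k.+1, b <- compositions m' (k - t)]
  end.

Lemma compositionsS m k : compositions m.+1 k =
  [seq [tuple of (t : nat) :: (b : m.-tuple nat)]
     | t <- iota 0 k.+1, b <- compositions m (k - t)].
Proof. by []. Qed.

Lemma mem_compositions m k (a : m.-tuple nat) :
  (a \in compositions m k) = (sumn a == k).
Proof.
elim: m k a => [|m ih] k a.
  by rewrite tuple0; case: k => [|k] //=; rewrite inE.
rewrite compositionsS; apply/allpairsPdep/idP => [[t [b]]|].
  rewrite mem_iota ltnS ih /=.
  by move=> -[tk /eqP bk ->]; rewrite /= bk; lia.
case/tupleP: a => t b /eqP tbk; exists t, b; rewrite mem_iota ih.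
by move: tbk => /= tbk; split=> //; [lia | apply/eqP; lia].
Qed.

Lemma cons_tuple_inj m (t t' : nat) (b b' : m.-tuple nat) :
  [tuple of t :: b] = [tuple of t' :: b'] -> t = t' /\ b = b'.
Proof. by move=> /(congr1 val)[-> /val_inj]. Qed.

Lemma compositions_uniq m k : uniq (compositions m k).
Proof.
elim: m k => [|m ih] k; first by case: k.
rewrite compositionsS; apply: allpairs_uniq_dep => [|t _|];
  [exact: iota_uniq | exact: ih |].
by move=> [t b] [t' b'] _ _ /= /cons_tuple_inj[-> ->].
Qed.

Definition down_closed m (D : pred (m.-tuple nat)) : Prop :=
  forall a b : m.-tuple nat,
    (forall i, (tnth a i <= tnth b i)%N) -> D b -> D a.

(** Slice a down-set by the first coordinate [t]. The slices decrease, hence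
    are constant from some [s0] on; beyond [s0] the count is a sum of the
    values of one eventually polynomial function. *)
Lemma count_down_closed_polynomial m (D : pred (m.-tuple nat)) :
  down_closed D ->
  eventually_polynomial (fun k => (count D (compositions m k))%:R).
Proof.
elim: m D => [|m ih] D Ddown.
  apply: (@eventually_polynomial_ext (fun=> 0) _ 1).
    by case.
  exact: eventually_polynomial_const.
pose slice t : pred (m.-tuple nat) := fun b => D [tuple of t :: b].
have sliceP t : down_closed (slice t).
  move=> a b ab; apply: Ddown => i; case: (unliftP ord0 i) => [j ->|->] //.
  by rewrite !tnthS.
have slice_le t t' b : (t <= t')%N -> slice t' b -> slice t b.
  move=> tt'; apply: Ddown => i; case: (unliftP ord0 i) => [j ->|->] //.
  by rewrite !tnthS.
have [||s0 s0P] := @upset_chain_stable m (fun t b => ~~ slice t b).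
- by move=> t a b ab; apply: contra; apply: sliceP.
- by move=> t a; apply/contra/slice_le.
have stable t : (s0 <= t)%N -> slice t =1 slice s0.
  move=> s0t b; apply/idP/idP; first exact: slice_le.
  by apply: contraLR; apply: s0P.
pose f t k : rat := (count (slice t) (compositions m k))%:R.
have fP t : eventually_polynomial (f t) by apply: ih.
have := eventually_polynomial_partial_sums (fP s0).
move/(eventually_polynomial_shift 1 s0).
have := eventually_polynomial_sum (index_enum 'I_s0)
  (fun t : 'I_s0 => eventually_polynomial_shift 0 t (fP t)).
move=> p1 p2;
  apply: (@eventually_polynomial_ext _ _ s0) (eventually_polynomialD p1 p2).
move=> k s0k /=.
have -> : count D (compositions m.+1 k)
    = \sum_(0 <= t < k.+1) count (slice t) (compositions m (k - t)).
  rewrite compositionsS count_flatten sumnE !big_map /index_iota subn0.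
  by apply: eq_bigr => t _; rewrite count_map.
rewrite natr_sum (big_cat_nat (leq0n s0) (leqW s0k)) /=.
congr (_ + _).
  by rewrite big_mkord; apply: eq_bigr => t _; rewrite /f addn0.
rewrite -[s0 in RHS]add0n big_addn big_mkord addn1 [RHS](reindex_inj
  rev_ord_inj).
apply: eq_bigr => t _ /=; rewrite /f; congr (_%:R).
rewrite (eq_count (stable _ _)); last by lia.
by congr (count _ (compositions _ _)); have := ltn_ord t; lia.
Qed.

Lemma card_down_closed_polynomial m (D : pred 'X_{1..m}) :
  (forall a b, D (a + b)%MM -> D a) ->
  eventually_polynomial
    (fun k => #|[pred a : 'X_{1..m < k.+1} | (mdeg a == k) && D a]|%:R).
Proof.
move=> Ddown.
have := @count_down_closed_polynomial m (fun a => D (Multinom a)).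
case=> [a b ab|P [K PK]].
  have /submK <- : (Multinom a <= Multinom b)%MM by apply/mnm_lepP.
  by rewrite addmC; apply: Ddown.
exists P, K => k Kk; rewrite -PK //; congr (_%:R).
rewrite -size_filter cardE.
rewrite -(size_map (fun a : 'X_{1..m < k.+1} => val (bmnm a))).
apply: perm_size; apply: uniq_perm.
- rewrite map_inj_uniq ?enum_uniq // => a b /val_inj/val_inj.
  by apply.
- by rewrite filter_uniq // compositions_uniq.
move=> a; rewrite mem_filter mem_compositions.
have sumE : sumn a = mdeg (Multinom a) by rewrite sumnE.
apply/mapP/andP => [[b]|[Da /eqP ak]].
  rewrite mem_enum inE => /andP[/eqP bk Db] ->.
  by split; [case: (bmnm b) Db | rewrite sumnE; apply/eqP].
have aP : (mdeg (Multinom a) < k.+1)%N by rewrite -sumE ak.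
exists (BMultinom aP) => //.
by rewrite mem_enum inE /= -sumE ak eqxx.
Qed.

(** * Hilbert functions of modules generated in one degree *)

Lemma qdim_fintype (F : fieldType) (A : nzRingType) (iota : {rmorphism F -> A})
    (V : lmodType A) (W B : V -> Prop) (T : finType) (P : pred T) (x : T -> V) :
  (forall t, P t -> W (x t)) ->
  (forall w, W w -> exists c, B (w - \sum_(t | P t) iota (c t) *: x t)) ->
  (forall c, B (\sum_(t | P t) iota (c t) *: x t) -> forall t,
    P t -> c t = 0) ->
  qdim iota W B #|P|.
Proof.
move=> Wx gen free; exists (fun i => x (enum_val i)).
have sumE c : \sum_(t | P t) iota (c t) *: x t
    = lincomb iota (fun i : 'I_#|P| => c (enum_val i)) (fun i => x (enum_val
      i)).
  by rewrite /lincomb -(big_enum_val (fun t => iota (c t) *: x t)).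
split.
- by move=> i; apply/Wx/(enum_valP i).
- move=> w /gen[c Bc]; exists (fun i => c (enum_val i)); by rewrite -sumE.
- move=> c Bc.
  pose c' t := if [pick i | enum_val (A := P) i == t] is Some i then c i else 0.
  have c'E i : c' (enum_val i) = c i.
    rewrite /c'; case: pickP => [j /eqP /enum_val_inj -> //|/(_ i)].
    by rewrite eqxx.
  move=> i; rewrite -c'E; apply: free; last exact: (enum_valP i).
  congr B: Bc; rewrite sumE.
  by apply: eq_bigr => j _; rewrite c'E.
Qed.

Section HilbertFunction.

Variables (F : fieldType) (A : comNzRingType) (iota : {rmorphism F -> A}).
Variables (V : lmodType A) (m : nat) (g : 'I_m -> A) (q : nat) (v : 'I_q -> V).

Definition monomial_vector (a : 'I_q) (e : 'X_{1..m}) : V := mmap1 g e *: v a.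

Definition degree_part (k : nat) (x : V) : Prop :=
  exists a e, mdeg e = k /\ x = monomial_vector a e.

Definition term_key (a : 'I_q) (e : 'X_{1..m}) : 'I_q *l 'X_{1..m} := (a, e).

(** Monomials of a free module of rank [q] are compared first by their basis
    vector, then by their exponent. This order is compatible with multiplication
    by a monomial, so that multiples of reducible monomials are reducible: the
    reducible ones are the leading monomials of the relations between the values
    in [V]. *)
Definition smaller_monomials (a : 'I_q) (e : 'X_{1..m}) (x : V) : Prop :=
  exists b f, [/\ mdeg f = mdeg e, (term_key b f < term_key a e)%O
                & x = monomial_vector b f].

Definition reducible a e : bool :=
  excluded_middle_informative
    (span iota (smaller_monomials a e) (monomial_vector a e)).

Lemma reducibleP a e :
  reflect (span iota (smaller_monomials a e) (monomial_vector a e))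
    (reducible a e).
Proof. by rewrite /reducible; case: excluded_middle_informative;
  constructor. Qed.

Lemma monomial_vectorM a e f :
  monomial_vector a (e + f) = mmap1 g f *: monomial_vector a e.
Proof.
rewrite /monomial_vector scalerA mulrC commr_mmap1_M // => i x.
exact: mulrC.
Qed.

Lemma reducibleM a e f : reducible a e -> reducible a (e + f)%MM.
Proof.
move=> /reducibleP ared; apply/reducibleP; rewrite monomial_vectorM.
elim: ared => [|c x w [b [h [he hlt ->]]] _ ih].
  by rewrite scaler0; apply: span_nil.
rewrite scalerDr scalerA mulrC -scalerA -monomial_vectorM.
apply: span_cons ih; exists b, (h + f)%MM; split=> //.
  by rewrite !mdegD he.
by move: hlt; rewrite !ltxi_pair ltmc_add2l.
Qed.

Definition basis_monomials k : pred ('I_q * 'X_{1..m < k.+1}) :=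
  fun t => (mdeg t.2 == k) && ~~ reducible t.1 t.2.

Arguments basis_monomials : clear implicits.

(** Irreducible monomials are a basis: repeated reduction ends because only
    finitely many monomials have degree [k], and the largest monomial of a
    linear relation would be reducible. *)
Lemma qdim_degree_part k :
  qdim iota (span iota (degree_part k)) (fun x => x = 0) #|basis_monomials k|.
Proof.
pose x (t : 'I_q * 'X_{1..m < k.+1}) := monomial_vector t.1 t.2.
apply: (@qdim_fintype _ _ _ _ _ _ _ _ x).
- by move=> t /andP[/eqP tk _]; apply: span_in; exists t.1, (bmnm t.2).
- have red n : forall t : 'I_q * 'X_{1..m < k.+1}, mdeg t.2 = k ->
    (#|[pred s : 'I_q * 'X_{1..m < k.+1} |
        (term_key s.1 s.2 < term_key t.1 t.2)%O]| < n)%N ->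
    exists c, x t = \sum_(s | basis_monomials k s) iota (c s) *: x s.
    elim: n => [//|n ih] t tk tn.
    have [tred|tirr] := boolP (reducible t.1 t.2); last first.
      exists (fun s => (s == t)%:R); rewrite (bigD1 t) /=; last first.
        by rewrite /basis_monomials tk eqxx.
      rewrite eqxx rmorph1 scale1r big1 ?addr0 // => s /andP[_ /negbTE ->].
      by rewrite rmorph0 scale0r.
    move/reducibleP: tred; rewrite -[monomial_vector _ _]/(x t).
    apply: (@span_min _ _ iota _ _ (fun y =>
      exists c, y = \sum_(s | basis_monomials k s) iota (c s) *: x s)).
    + exists (fun=> 0); rewrite big1 // => s _.
      by rewrite rmorph0 scale0r.
    + move=> u w [c ->] [c' ->]; exists (fun s => c s + c' s).
      by rewrite -big_split; apply: eq_bigr => s _; rewrite rmorphD scalerDl.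
    + move=> d _ [b [f [fe flt ->]]].
      have fk : (mdeg f < k.+1)%N by rewrite fe tk.
      have [||c cE] := ih (b, BMultinom fk).
      * by rewrite fe.
      * rewrite -ltnS; apply: leq_trans tn; rewrite ltnS.
        apply/proper_card/properP; split.
          by apply/subsetP => s; rewrite !inE => /lt_trans; apply.
        by exists (b, BMultinom fk); rewrite !inE ?ltxx.
      * exists (fun s => d * c s);
        rewrite -[monomial_vector b f]/(x (b, BMultinom fk)).
        rewrite cE scaler_sumr; apply: eq_bigr => s _.
        by rewrite scalerA -rmorphM.
  apply: (@span_min _ _ iota _ _ (fun w =>
    exists c, w - \sum_(s | basis_monomials k s) iota (c s) *: x s = 0)).
  + exists (fun=> 0); rewrite big1 ?subr0 // => s _.
    by rewrite rmorph0 scale0r.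
  + move=> u u' [c cE] [c' c'E]; exists (fun s => c s + c' s).
    rewrite (eq_bigr (fun s => iota (c s) *: x s + iota (c' s) *: x s)).
      by rewrite big_split opprD addrACA cE c'E addr0.
    by move=> s _; rewrite rmorphD scalerDl.
  + move=> d _ [a [e [ek ->]]].
    have ek' : (mdeg e < k.+1)%N by rewrite ek.
    have [c cE] := red _ (a, BMultinom ek') ek (ltnSn _).
    exists (fun s => d * c s);
      rewrite -[monomial_vector a e]/(x (a, BMultinom ek')).
    rewrite cE scaler_sumr -sumrB big1 // => s _.
    by rewrite scalerA -rmorphM subrr.
- move=> c c0 t0 t0P; apply/eqP; case: eqP => // /eqP ct0.
  (* The leading monomial of the relation. *)
  pose N t := basis_monomials k t && (c t != 0).
  pose t := [arg max_(t > t0 | N t) term_key t.1 t.2]%O.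
  have : N t /\ forall s, N s -> (term_key s.1 s.2 <= term_key t.1 t.2)%O.
    rewrite /t; case: arg_maxP => [|s Ns smax]; first by rewrite /N t0P.
    by [].
  case=> /andP[tP ct] tmax; have /andP[/eqP tk /negP[]] := tP.
  apply/reducibleP; move/eqP: c0; rewrite (bigD1 t) //= addrC addr_eq0.
  move/eqP/(congr1 (fun y => iota (- (c t)^-1) *: y)).
  rewrite scalerN scalerA -rmorphM mulNr mulVf // rmorphN1 scaleN1r opprK.
  rewrite -[monomial_vector _ _]/(x t) => <-;
    apply/spanZ/span_sum => s /andP[sP st].
  have [->|cs] := eqVneq (c s) 0.
    by rewrite rmorph0 scale0r; apply: span_nil.
  apply/spanZ/span_in; exists s.1, (bmnm s.2); split=> //.
    by have /andP[/eqP -> _] := sP.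
  rewrite lt_neqAle tmax ?andbT; last by rewrite /N sP.
  apply: contra st => /eqP[e1 e2]; apply/eqP.
  by case: (s) (t) e1 e2 => [s1 s2] [t1 t2] /= -> /val_inj ->.
Qed.

(** The irreducible exponents at each basis vector form a down-set, and counting
    a down-set by degree is eventually polynomial. *)
Theorem degree_part_hilbert_polynomial : exists h : nat -> nat,
  eventually_polynomial (fun k => (h k)%:R) /\
  forall k, qdim iota (span iota (degree_part k)) (fun x => x = 0) (h k).
Proof.
exists (fun k => #|basis_monomials k|); split; last exact: qdim_degree_part.
pose D (a : 'I_q) (e : 'X_{1..m}) := ~~ reducible a e.
have := @eventually_polynomial_sum _ (index_enum 'I_q) (fun a k =>
  #|[pred e : 'X_{1..m < k.+1} | (mdeg e == k) && D a e]|%:R).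
case=> [a|P [K PK]].
  apply: card_down_closed_polynomial => e f; apply: contra.
  exact: reducibleM.
exists P, K => k Kk; rewrite -PK // -natr_sum; congr (_%:R).
rewrite -sum1_card; under [RHS]eq_bigr do rewrite -sum1_card.
by rewrite pair_big_dep; apply: eq_bigl.
Qed.

End HilbertFunction.

(** * Noetherianity of polynomial rings *)

Section Noetherian.

Variables (F : fieldType) (n : nat).
Local Notation S := {mpoly F[n]}.

Definition submodule (A : nzRingType) (V : lmodType A) (W : V -> Prop) : Prop :=
  W 0 /\ forall c u v, W u -> W v -> W (c *: u + v).

Lemma submoduleB (A : nzRingType) (V : lmodType A) (W : V -> Prop) u v :
  submodule W -> W u -> W v -> W (u - v).
Proof.
by case=> _ Wl Wu Wv; rewrite addrC -scaleN1r; apply: Wl.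
Qed.

Lemma submodule_span (A : nzRingType) (V : lmodType A) (X : V -> Prop) :
  submodule (span (idfun : {rmorphism A -> A}) X).
Proof.
split=> [|c u v Xu Xv]; first exact: span_nil.
by apply: spanD => //; apply: (@spanZ _ _ (idfun : {rmorphism A -> A})).
Qed.

(** Once the leading monomials of a chain of ideals are constant, so is the
    chain: subtracting from [p] a multiple of an element of the smaller ideal
    with the same leading monomial lowers the leading monomial of [p]. *)
Lemma ideal_chain_stable (J : nat -> S^o -> Prop) :
  (forall s, submodule (J s)) -> (forall s p, J s p -> J s.+1 p) ->
  exists s0, forall s p, J s p -> J s0 p.
Proof.
move=> Jsub inc.
have mono s s' p : (s <= s')%N -> J s p -> J s' p.
  by move=> /subnK <-; elim: (s' - s)%N => // j ih Js; apply/inc/ih.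
pose L s e := exists p : S, [/\ J s p, p != 0 & mlead p = e].
have [||s0 s0P] := @monomial_upset_chain_stable n L.
- move=> s e f [p [Jp p0 <-]]; exists (p * 'X_[f]); split.
  + by rewrite mulrC -[_ * _]addr0; apply: (Jsub s).2 => //; apply: (Jsub s).1.
  + by rewrite mulf_neq0 // -msupp_eq0 msuppX.
  + by rewrite mleadM ?mleadXm // -msupp_eq0 msuppX.
- by move=> s e [p [Jp p0 pe]]; exists p; split=> //; apply: inc.
exists s0 => s p Jp; have [ss0|/ltnW s0s] := leqP s s0; first exact: mono Jp.
move: p Jp; suff H e : forall p : S, mlead p = e -> J s p -> J s0 p.
  by move=> p; apply: H.
elim/(@ltmwf n): e => e ih p pe Jp.
have [->|p0] := eqVneq p 0; first exact: (Jsub s0).1.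
have [|r [Jr r0 re]] := s0P s e; first by exists p.
pose c := p@_e / r@_e.
have re0 : r@_e != 0 by rewrite -re mleadc_eq0.
have Jcr : J s0 (c%:MP * r).
  by rewrite -[_ * _]addr0; apply: (Jsub s0).2 => //; apply: (Jsub s0).1.
suff Jd : J s0 (p - c%:MP * r).
  have -> : p = 1 *: (p - c%:MP * r : S^o) + c%:MP * r.
    by rewrite scale1r subrK.
  exact: (Jsub s0).2.
have [->|d0] := eqVneq (p - c%:MP * r) 0; first exact: (Jsub s0).1.
apply: (ih (mlead (p - c%:MP * r))) => //; last first.
  exact/(submoduleB (Jsub s))/(mono s0).
rewrite lt_neqAle; apply/andP; split.
  apply: contraNneq d0 => de; rewrite -mleadc_eq0 de mcoeffB mul_mpolyC.
  by rewrite mcoeffZ /c divfK // subrr.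
apply: le_trans (mleadB_le _ _) _; rewrite leUx pe lexx /= mul_mpolyC -re.
exact: mleadZ_le.
Qed.

(** Induction on the number [j] of coordinates that may be nonzero, the last [j]
    ones: the ideals of values of the first of them reduce [j] to [j.-1]. *)
Lemma submodule_chain_stable q (N : nat -> 'rV[S]_q -> Prop) :
  (forall s, submodule (N s)) -> (forall s u, N s u -> N s.+1 u) ->
  exists s0, forall s u, N s u -> N s0 u.
Proof.
move=> Nsub inc.
have mono s s' u : (s <= s')%N -> N s u -> N s' u.
  by move=> /subnK <-; elim: (s' - s)%N => // j ih Ns; apply/inc/ih.
suff H j : (j <= q)%N -> exists s0, forall s (u : 'rV[S]_q),
    (forall b : 'I_q, (b < q - j)%N -> u 0 b = 0) -> N s u -> N s0 u.
  have [s0 s0P] := H q (leqnn q); exists s0 => s u; apply: s0P => b.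
  by rewrite subnn.
elim: j => [|j ih] jq.
  exists 0%N => s u u0 _; suff -> : u = 0 by apply: (Nsub 0%N).1.
  by apply/rowP => b; rewrite mxE u0 // subn0.
have [s1 s1P] := ih (ltnW jq).
have tq : (q - j.+1 < q)%N by lia.
pose t := Ordinal tq.
have [||s2 s2P] := @ideal_chain_stable (fun s p => exists u : 'rV[S]_q,
    [/\ N s u, forall b : 'I_q, (b < t)%N -> u 0 b = 0 & u 0 t = p]).
- move=> s; split.
    exists 0; split; [exact: (Nsub s).1 | by move=> b _; rewrite mxE |].
    by rewrite mxE.
  move=> c _ _ [u [Nu u0 <-]] [v [Nv v0 <-]]; exists (c *: u + v); split.
  + exact: (Nsub s).2.
  + by move=> b bt; rewrite !mxE u0 // v0 // mulr0 addr0.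
  + by rewrite !mxE.
- by move=> s p [u [Nu u0 up]]; exists u; split=> //; apply: inc.
exists (maxn s1 s2) => s u u0 Nu.
have [|u' [Nu' u'0 u't]] := s2P s (u 0 t); first by exists u; split.
rewrite -(subrK u' u) -[X in X + _]scale1r; apply: (Nsub _).2; last first.
  exact/(mono s2)/Nu'/leq_maxr.
apply/(mono s1); first exact: leq_maxl.
apply: (s1P (maxn s s2)) => [b bt|].
  rewrite !mxE; have [bt'|tb] := ltnP b t; first by rewrite u0 ?u'0 ?subr0.
  by have -> : b = t; [apply: val_inj => /=; move: bt tb => /=;
    lia | rewrite u't subrr].
apply: submoduleB => //.
  by apply: mono Nu; apply: leq_maxl.
by apply: mono Nu'; apply: leq_maxr.
Qed.

(** Otherwise, adding again and again an element of [X] outside the submodule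
    generated so far would give a chain that is not stationary. *)
Lemma finitely_generated q (X : 'rV[S]_q -> Prop) :
  exists l : seq 'rV[S]_q, (forall x, x \in l -> X x) /\
    forall x, X x -> span (idfun : {rmorphism S -> S}) (fun y => y \in l) x.
Proof.
apply: Classical_Prop.NNPP => noL.
pose sp (l : seq 'rV[S]_q) :=
  span (idfun : {rmorphism S -> S}) (fun y => y \in l).
pose pick l := epsilon (inhabits (0 : 'rV[S]_q)) (fun x => X x /\ ~ sp l x).
have pickP l : (forall x, x \in l -> X x) -> X (pick l) /\ ~ sp l (pick l).
  move=> lX; apply: (@epsilon_spec _ _ (fun x => X x /\ ~ sp l x));
    apply: Classical_Prop.NNPP => no.
  apply: noL; exists l; split=> // x Xx; apply: Classical_Prop.NNPP => nspx.
  by apply: no; exists x.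
pose L s := iter s (fun l => pick l :: l) [::].
have LX s : forall x, x \in L s -> X x.
  elim: s => [//|s ih] x; rewrite inE => /predU1P[->|]; last exact: ih.
  by case: (pickP _ ih).
have [||s0 s0P] := @submodule_chain_stable q (fun s => sp (L s)).
- by move=> s; apply: submodule_span.
- move=> s u; apply: (@span_span _ _ (idfun : {rmorphism S -> S})) => x xL;
  apply: span_in.
  by rewrite inE xL orbT.
case: (pickP _ (LX s0)) => _; apply; apply: (s0P s0.+1).
by apply: span_in; rewrite inE eqxx.
Qed.

End Noetherian.

(** * Homogeneous components *)

Section Homogeneous.

Variables (F : fieldType) (n : nat).
Local Notation S := {mpoly F[n]}.
Implicit Types (p g : S) (e f : int).

(** Degrees are integers, as in a graded free resolution; there are no
    polynomials of negative degree. *)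
Definition hcomp e p : S := if e is Posz d then pihomog mdeg d p else 0.

Fact hcomp_is_linear e : linear (hcomp e).
Proof.
by case: e => d c u v /=; rewrite ?scaler0 ?addr0 // linearP.
Qed.

HB.instance Definition _ e :=
  GRing.isLinear.Build F S S _ (hcomp e) (hcomp_is_linear e).

Lemma mcoeff_hcomp e p m : (hcomp e p)@_m = if (mdeg m)%:Z == e then p@_m else
  0.
Proof.
case: e => d /=; last by rewrite mcoeff0.
have [mem|/memN_msupp_eq0 pm] := boolP (m \in msupp p); last first.
  rewrite pm if_same (pihomogwE _ _ (leqnn _)) raddf_sum big1 // => l _ /=.
  rewrite mcoeffZ mcoeffX; case: eqP => [->|_]; last by rewrite mulr0.
  by rewrite pm mul0r.
rewrite pihomogE raddf_sum /= (eq_bigr (fun l => p@_l * (l == m)%:R));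
  last first.
  by move=> l _; rewrite mcoeffZ mcoeffX.
rewrite eqz_nat; have [md|md] := eqVneq (mdeg m) d.
  rewrite big_mkcond (bigD1_seq m) ?msupp_uniq //= md eqxx eqxx mulr1.
  rewrite big1 ?addr0 // => l /negbTE ->; rewrite mulr0.
  by case: ifP.
rewrite big1 // => l /eqP ld; case: eqP => [lm|_]; last by rewrite mulr0.
by move: md; rewrite -lm ld eqxx.
Qed.

Lemma homog_of_degreeP e p : homog_of_degree e p <-> hcomp e p = p.
Proof.
split=> [hom|<- m].
  apply/mpolyP => m; rewrite mcoeff_hcomp; case: eqP => // ne.
  by apply/esym/memN_msupp_eq0/negP => /hom.
rewrite mcoeff_msupp mcoeff_hcomp; case: ifP => [/eqP -> //|_].
by rewrite eqxx /=.
Qed.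

Lemma hcomp_id e p : hcomp e (hcomp e p) = hcomp e p.
Proof. by apply/mpolyP => m; rewrite !mcoeff_hcomp; case: (_ == e). Qed.

Lemma hcomp_homog e p : homog_of_degree e (hcomp e p).
Proof. exact/homog_of_degreeP/hcomp_id. Qed.

Lemma homog_neg d p : homog_of_degree (Negz d) p -> p = 0.
Proof. by move/homog_of_degreeP. Qed.

Lemma homog0 e : homog_of_degree e (0 : S).
Proof. by move=> m; rewrite msupp0. Qed.

Lemma homogE d p : homog_of_degree d%:Z p <-> p \is d.-homog.
Proof.
split=> [hom|/dhomogP hom m /hom -> //].
by apply/dhomogP => m /hom [].
Qed.

Lemma hcompX e m : hcomp e 'X_[m] = if (mdeg m)%:Z == e then 'X_[m] else 0.
Proof.
apply/mpolyP => l; rewrite mcoeff_hcomp mcoeffX.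
have [<-|ml] := eqVneq m l; first by case: ifP; rewrite ?mcoeffX ?eqxx ?mcoeff0.
by rewrite if_same; case: ifP; rewrite ?mcoeff0 // mcoeffX (negbTE ml).
Qed.

Lemma hcompM e f p g : homog_of_degree f g ->
  hcomp e (p * g) = hcomp (e - f) p * g.
Proof.
move=> homg; rewrite [g]mpolyE !mulr_sumr linear_sum /=.
apply: eq_big_seq => m /homg mf; rewrite -!scalerAr linearZ /=; congr (_ *: _).
rewrite [p]mpolyE mulr_suml !linear_sum /= mulr_suml; apply: eq_bigr => l _.
rewrite -scalerAl !linearZ /= -scalerAl -mpolyXD !hcompX; congr (_ *: _).
rewrite mdegD PoszD mf eq_sym -subr_eq eq_sym.
by case: ifP; rewrite ?mul0r // mpolyXD.
Qed.

(** Both gradings, the homological one [K] on rows and the internal one, are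
    expressed by a projection: a matrix is bihomogeneous if [bicomp] fixes it.
    As the projection commutes with graded matrices on both sides, a preimage of
    a bihomogeneous matrix can be replaced by its component. *)
Definition bicomp r q (K : 'I_r -> nat) (h : nat) (e : 'I_q -> int)
    (w : 'M[S]_(r, q)) : 'M[S]_(r, q) :=
  \matrix_(A, b) if K A == h then hcomp (e b - h%:Z) (w A b) else 0.

Lemma bicompD r q (K : 'I_r -> nat) h (e : 'I_q -> int) u v :
  bicomp K h e (u + v) = bicomp K h e u + bicomp K h e v.
Proof.
apply/matrixP => A b; rewrite !mxE; case: (K A == h); rewrite ?addr0 //.
by rewrite raddfD.
Qed.

Lemma bicompZ r q (K : 'I_r -> nat) h (e : 'I_q -> int) c u :
  bicomp K h e (c%:MP *: u) = c%:MP *: bicomp K h e u.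
Proof.
apply/matrixP => A b; rewrite !mxE; case: (K A == h); rewrite ?mulr0 //.
by rewrite !mul_mpolyC linearZ.
Qed.

Lemma bicomp0 r q (K : 'I_r -> nat) h (e : 'I_q -> int) :
  bicomp K h e 0 = 0.
Proof. by apply/matrixP => A b; rewrite !mxE raddf0 if_same. Qed.

Lemma bicomp_id r q (K : 'I_r -> nat) h (e : 'I_q -> int) w :
  bicomp K h e (bicomp K h e w) = bicomp K h e w.
Proof.
by apply/matrixP => A b; rewrite !mxE; case: (K A == h); rewrite ?hcomp_id.
Qed.

Lemma bicompP r q (K : 'I_r -> nat) h (e : 'I_q -> int) w :
  bicomp K h e w = w <-> forall A b,
    (K A != h -> w A b = 0) /\ homog_of_degree (e b - h%:Z) (w A b).
Proof.
split=> [<- A b|wP].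
  rewrite mxE; split=> [/negbTE -> //|].
  by case: ifP => _; [apply: hcomp_homog | apply: homog0].
apply/matrixP => A b; rewrite mxE; have [w0 /homog_of_degreeP hw] := wP A b.
by case: eqP => [//|/eqP/w0 ->].
Qed.

Lemma bicomp_mulr r q q' (K : 'I_r -> nat) h (e : 'I_q -> int)
    (e' : 'I_q' -> int) u (D : 'M[S]_(q, q')) :
  (forall a b, homog_of_degree (e' b - e a) (D a b)) ->
  bicomp K h e' (u *m D) = bicomp K h e u *m D.
Proof.
move=> homD; apply/matrixP => A b; rewrite !mxE.
case: ifP => KA; last first.
  by rewrite big1 // => a _; rewrite mxE KA mul0r.
rewrite raddf_sum; apply: eq_bigr => a _ /=; rewrite (hcompM _ _ (homD a b)).
by rewrite mxE KA; congr (hcomp _ _ * _); ring.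
Qed.

Lemma bicomp_mull r q (K : 'I_r -> nat) h (e : 'I_q -> int)
    (D : 'M[S]_r) w :
  (forall A B, homog_of_degree 1 (D A B)) ->
  (forall A B, K B != (K A).+1 -> D A B = 0) ->
  bicomp K h e (D *m w) = D *m bicomp K h.+1 e w.
Proof.
move=> homD grD; apply/matrixP => A b; rewrite !mxE.
case: eqP => [KA|/eqP KA].
  rewrite raddf_sum; apply: eq_bigr => B _ /=; rewrite mxE -KA.
  case: eqP => [KB|/eqP KB]; last by rewrite grD // mul0r raddf0 mul0r.
  rewrite mulrC (hcompM _ _ (homD A B)) mulrC; congr (_ * hcomp _ _).
  by rewrite -addn1 PoszD; ring.
rewrite big1 // => B _; rewrite mxE; case: eqP => [KB|]; last by rewrite mulr0.
by rewrite grD ?mul0r // KB eqSS eq_sym.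
Qed.

(** * Existence of graded free resolutions *)

Lemma sum_hcomp (d : int) (E : seq int) p :
  uniq E -> (forall m, m \in msupp p -> d + (mdeg m)%:Z \in E) ->
  \sum_(e <- E) hcomp (e - d) p = p.
Proof.
move=> uE Ep; apply/mpolyP => m; rewrite raddf_sum /=.
have [/Ep mE|/memN_msupp_eq0 pm] := boolP (m \in msupp p); last first.
  by rewrite pm big1 // => e _; rewrite mcoeff_hcomp pm if_same.
rewrite (bigD1_seq _ mE uE) /= mcoeff_hcomp [_ + _ - d]addrAC subrr add0r eqxx.
rewrite big1 ?addr0 // => e ne; rewrite mcoeff_hcomp; case: eqP => // me.
by move: ne; rewrite me addrC subrK eqxx.
Qed.

(** The homogeneous vectors of the kernel are generated by finitely many of
    them, and every vector of the kernel is the sum of its components. *)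
Lemma homogeneous_kernel a b (da : 'I_a -> int) (db : 'I_b -> int)
    (D : 'M[S]_(a, b)) :
  (forall i k, homog_of_degree (da i - db k) (D i k)) ->
  exists c (dc : 'I_c -> int) (D' : 'M[S]_(c, a)),
    (forall i k, homog_of_degree (dc i - da k) (D' i k)) /\
    forall u : 'rV_a, u *m D = 0 <-> exists v : 'rV_c, u = v *m D'.
Proof.
move=> homD.
pose X (u : 'rV[S]_a) := u *m D = 0 /\
  exists d, forall k, homog_of_degree (d - da k) (u 0 k).
have [l [lX lgen]] := finitely_generated X.
have [dc dcP] : exists dc : 'I_(size l) -> int,
    forall i k, homog_of_degree (dc i - da k) (l`_i 0 k).
  apply: (@fin_all_exists _ _ (fun (i : 'I_(size l)) d =>
    forall k, homog_of_degree (d - da k) (l`_i 0 k))) => i.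
  by case: (lX l`_i) => // ; apply: mem_nth.
exists (size l), dc, (\matrix_(i < size l) l`_i); split.
  by move=> i k; rewrite mxE; apply: dcP.
move=> u; split=> [uD|[v ->]]; last first.
  rewrite -mulmxA (_ : _ *m D = 0) ?mulmx0 //; apply/row_matrixP => i.
  by rewrite row_mul rowK row0; case: (lX l`_i) => //; apply: mem_nth.
have gen x : span (idfun : {rmorphism S -> S}) (fun y => y \in l) x ->
    exists v : 'rV_(size l), x = v *m \matrix_(i < size l) l`_i.
  elim=> [|c y w yl _ [v ->]]; first by exists 0; rewrite mul0mx.
  have il : (index y l < size l)%N by rewrite index_mem.
  exists (c *: delta_mx 0 (Ordinal il) + v).
  by rewrite mulmxDl -scalemxAl -rowE rowK /= nth_index.
apply: gen.
pose row_comp d : 'rV[S]_a :=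
  @bicomp 1 a (fun=> 0%N) 0 (fun k => d - da k) u.
pose E := undup [seq da km.1 + (mdeg km.2)%:Z |
  km <- [seq (k, m) | k <- enum 'I_a, m <- msupp (u 0 k)]].
have -> : u = \sum_(d <- E) row_comp d.
  apply/rowP => k; rewrite summxE.
  rewrite (eq_bigr (fun d => hcomp (d - da k) (u 0 k))); last first.
    by move=> d _; rewrite mxE subr0.
  rewrite sum_hcomp ?undup_uniq // => m mu; rewrite mem_undup.
  apply/mapP; exists (k, m) => //; apply/allpairsPdep; exists k, m.
  by rewrite mem_enum.
apply: (@span_sum _ _ (idfun : {rmorphism S -> S})) => d _; apply: lgen; split.
  rewrite /row_comp -(@bicomp_mulr _ _ _ _ _ _ (fun k => d - db k)).
    by rewrite uD bicomp0.
  move=> i k.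
  have -> : d - db k - (d - da i) = da i - db k by ring.
  exact: homD.
by exists d => k; rewrite mxE /= subr0; apply: hcomp_homog.
Qed.

Record homogeneous_map (b : nat) (db : 'I_b -> int) := HomogeneousMap {
  hm_rank : nat;
  hm_deg : 'I_hm_rank -> int;
  hm_mx : 'M[S]_(hm_rank, b);
  hm_homog : forall i k, homog_of_degree (hm_deg i - db k) (hm_mx i k)
}.

Lemma kernel_map b (db : 'I_b -> int) (X : homogeneous_map db) :
  { Y : homogeneous_map (@hm_deg _ _ X) |
    forall u : 'rV_(hm_rank X),
      u *m hm_mx X = 0 <-> exists v : 'rV_(hm_rank Y), u = v *m hm_mx Y }.
Proof.
apply: constructive_indefinite_description.
have [c [dc [D' [homD' ex]]]] := homogeneous_kernel (@hm_homog _ _ X).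
by exists (HomogeneousMap homD').
Qed.

(** A resolution is built by iterating [next_stage], whose rank is by
    computation the rank of the source of the previous map; consecutive maps can
    thus be composed without casts. *)
Record resolution_stage := ResolutionStage {
  stage_rank : nat;
  stage_deg : 'I_stage_rank -> int;
  stage_map : homogeneous_map stage_deg
}.

Definition next_stage (X : resolution_stage) : resolution_stage :=
  ResolutionStage (sval (kernel_map (stage_map X))).

Lemma graded_free_resolution_exists (J : S -> Prop) (d : nat) (gs : seq S) :
  (forall g, g \in gs -> g \is d.-homog) ->
  (forall p, J p <-> ideal_span gs p) ->
  inhabited (graded_free_resolution J).
Proof.
move=> homgs Jgs.
have aug_homog (i : 'I_(size gs)) (k : 'I_1) :
    homog_of_degree (d%:Z - 0) ((\col_(i < size gs) gs`_i) i k).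
  by rewrite mxE subr0; apply/homogE/homgs/mem_nth.
pose aug := @HomogeneousMap 1 (fun=> 0) _ (fun=> d%:Z) _ aug_homog.
pose st i := iter i next_stage (ResolutionStage (sval (kernel_map aug))).
constructor; apply: (@GradedFreeResolution F n J
  (fun i => stage_rank (st i)) (fun i => @stage_deg (st i))
  (fun i => hm_mx (stage_map (st i))) (\col_(i < size gs) gs`_i)).
- by move=> a; have := aug_homog a 0; rewrite subr0.
- by move=> i a b; apply: hm_homog.
- move=> p; rewrite Jgs; split=> [[c ->]|[u ->]].
    by exists (\row_i c i); rewrite mxE; apply: eq_bigr => i _; rewrite !mxE.
  by exists (fun i => u 0 i); rewrite mxE; apply: eq_bigr => i _; rewrite mxE.
- exact: (svalP (kernel_map aug)).
- by move=> i; apply: (svalP (kernel_map (stage_map (st i)))).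
Qed.

End Homogeneous.

(** * The Koszul complex *)

Section Koszul.

Variables (F : fieldType) (n : nat).
Local Notation S := {mpoly F[n]}.
Implicit Types (s : seq 'I_n).

Fixpoint kdim s : nat := if s is _ :: s' then (kdim s' + kdim s')%N else 1%N.

Fixpoint kdeg s : 'I_(kdim s) -> nat :=
  match s return 'I_(kdim s) -> nat with
  | [::] => fun=> 0%N
  | _ :: s' => fun A =>
      match split A with inl B => kdeg B | inr B => (kdeg B).+1 end
  end.

(** The Koszul complex on the variables of [s], with all exterior powers put
    together; [kdeg] records the exterior power of each basis vector. The matrix
    acts on columns from the left, so that it commutes with any matrix acting
    from the right. The complex on [i :: s] is the cone of multiplication by
    ['X_i] on the complex on [s]. *)
Fixpoint koszul s : 'M[S]_(kdim s) :=
  match s return 'M[S]_(kdim s) with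
  | [::] => 0
  | i :: s' => block_mx (koszul s') ('X_i)%:M 0 (- koszul s')
  end.

(** In the basis of [koszul], this is the de Rham differential of polynomial
    differential forms. *)
Fixpoint de_rham s q : 'M[S]_(kdim s, q) -> 'M[S]_(kdim s, q) :=
  match s return 'M[S]_(kdim s, q) -> 'M[S]_(kdim s, q) with
  | [::] => fun=> 0
  | i :: s' => fun w => col_mx (de_rham (usubmx w))
      (map_mx (mderiv i) (usubmx w) - de_rham (dsubmx w))
  end.

Lemma koszul_sqr s : koszul s *m koszul s = 0.
Proof.
elim: s => [|i s ih] /=; first by rewrite mul0mx.
rewrite mulmx_block !mulmx0 !mul0mx !mulmxN !mulNmx opprK ih !addr0.
by rewrite mul_scalar_mx mul_mx_scalar subrr block_mx0.
Qed.

Lemma koszul_entry s (P : S -> Prop) : P 0 ->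
  (forall i, i \in s -> P 'X_i) -> (forall p, P p -> P (- p)) ->
  forall A B, P (koszul s A B).
Proof.
move=> P0 PX PN; elim: s PX => [|i s ih] PX A B /=; first by rewrite mxE.
have {}ih A' B' : P (koszul s A' B').
  by apply: ih => j js; apply: PX; rewrite inE js orbT.
rewrite -(splitK A) -(splitK B);
  case: (split A) (split B) => [A'|A'] [B'|B'] /=.
- by rewrite block_mxEul.
- rewrite block_mxEur mxE; case: eqP => _; last by rewrite mulr0n.
  by rewrite mulr1n; apply: PX; rewrite inE eqxx.
- by rewrite block_mxEdl mxE.
- by rewrite block_mxEdr mxE; apply: PN.
Qed.

Lemma koszul_homog s A B : homog_of_degree 1 (koszul s A B).
Proof.
apply: koszul_entry => [|i _|p hp m]; first exact: homog0.
  by apply/homogE; rewrite dhomogX /= mdeg1.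
by rewrite (perm_mem (msuppN p)); apply: hp.
Qed.

Lemma kdeg_lshift i s (A : 'I_(kdim s)) :
  @kdeg (i :: s) (lshift (kdim s) A) = kdeg A.
Proof. by rewrite /= (unsplitK (inl A)). Qed.

Lemma kdeg_rshift i s (A : 'I_(kdim s)) :
  @kdeg (i :: s) (rshift (kdim s) A) = (kdeg A).+1.
Proof. by rewrite /= (unsplitK (inr A)). Qed.

Lemma koszul_kdeg s A B : kdeg B != (kdeg A).+1 -> koszul s A B = 0.
Proof.
elim: s A B => [|i s ih] A B; first by rewrite mxE.
rewrite -(splitK A) -(splitK B).
case: (split A) (split B) => [A'|A'] [B'|B'];
  rewrite ?(kdeg_lshift i) ?(kdeg_rshift i) => ne /=.
- by rewrite block_mxEul ih.
- rewrite block_mxEur mxE; case: eqP => [AB|_]; last by rewrite mulr0n.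
  by rewrite AB eqxx in ne.
- by rewrite block_mxEdl mxE.
- by rewrite block_mxEdr mxE ih ?oppr0.
Qed.

Lemma kdeg0_unique s : exists A0 : 'I_(kdim s),
  forall A, (kdeg A == 0%N) = (A == A0).
Proof.
elim: s => [|i s [A0 A0P]]; first by exists ord0 => A; rewrite ord1.
exists (lshift _ A0) => A; rewrite -(splitK A); case: (split A) => B /=.
  by rewrite (unsplitK (inl B)) A0P (inj_eq (@lshift_inj _ _)).
by rewrite (unsplitK (inr B)) eq_rlshift.
Qed.

Lemma de_rhamD s q : {morph @de_rham s q : u v / u + v}.
Proof.
elim: s => [|i s ih] u v /=; first by rewrite addr0.
rewrite !linearD /= !ih add_col_mx map_mxD; congr col_mx.
by rewrite opprD addrACA.
Qed.

Lemma de_rhamN s q : {morph @de_rham s q : u / - u}.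
Proof.
elim: s => [|i s ih] u /=; first by rewrite oppr0.
by rewrite !linearN /= !ih opp_col_mx map_mxN opprD.
Qed.

Lemma de_rhamZX s q i w : i \notin s ->
  @de_rham s q ('X_i *: w) = 'X_i *: de_rham w.
Proof.
elim: s w => [|j s ih] w /=; first by rewrite scaler0.
rewrite inE negb_or => /andP[ij si]; rewrite !linearZ /= !ih // scale_col_mx.
congr col_mx; rewrite scalerBr; congr (_ - _).
apply/matrixP => A b; rewrite !mxE mderivM mderivX mnm1E.
by rewrite (negbTE ij) scale0r mul0r add0r.
Qed.

Lemma mderiv_koszul s q i (w : 'M[S]_(kdim s, q)) : i \notin s ->
  map_mx (mderiv i) (koszul s *m w) = koszul s *m map_mx (mderiv i) w.
Proof.
move=> si; apply/matrixP => A b; rewrite !mxE raddf_sum;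
  apply: eq_bigr => B _ /=.
rewrite mderivM mxE (_ : mderiv i _ = 0) ?mul0r ?add0r //.
apply: (@koszul_entry s (fun p => mderiv i p = 0)) => [|j js|p p0].
- exact: mderiv0.
- rewrite mderivX mnm1E; case: eqP => [ji|_]; last by rewrite scale0r.
  by rewrite -ji js in si.
- by rewrite mderivN p0 oppr0.
Qed.

Definition euler s (p : S) : S := \sum_(i <- s) 'X_i * mderiv i p.

(** Cartan's formula for the Lie derivative along the Euler vector field. *)
Lemma koszul_homotopy s q (w : 'M[S]_(kdim s, q)) : uniq s ->
  de_rham (koszul s *m w) + koszul s *m de_rham w
  = \matrix_(A, b) (euler s (w A b) + w A b *+ kdeg A).
Proof.
elim: s w => [|i s ih] w /=.
  move=> _; rewrite mul0mx addr0; apply/matrixP => A b.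
  by rewrite !mxE /euler big_nil mulr0n addr0.
case/andP=> si us; rewrite -[w]vsubmxK; move: (usubmx w) (dsubmx w) => a c.
rewrite mul_block_col mul0mx add0r mul_scalar_mx !col_mxKu !col_mxKd.
rewrite mul_block_col mul0mx add0r mul_scalar_mx !mulNmx !mulmxBr !scalerBr.
rewrite !de_rhamD de_rhamN de_rhamZX // map_mxD mderiv_koszul // add_col_mx.
have ->: map_mx (mderiv i) ('X_i *: c) = c + 'X_i *: map_mx (mderiv i) c.
  apply/matrixP => A b; rewrite !mxE mderivM mderivX mnm1E eqxx scale1r.
  rewrite (_ : (U_(i) - U_(i))%MM = 0%MM) ?mpolyX0 ?mul1r //.
  by apply/mnmP => j; rewrite mnmBE mnm0E subnn.
set up := (X in col_mx X _); set dn := (X in col_mx _ X).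
have upE : up = (de_rham (koszul s *m a) + koszul s *m de_rham a)
    + 'X_i *: map_mx (mderiv i) a.
  by rewrite /up; apply/matrixP => A b; rewrite !mxE; ring.
have dnE : dn = (de_rham (koszul s *m c) + koszul s *m de_rham c)
    + c + 'X_i *: map_mx (mderiv i) c.
  by rewrite /dn; apply/matrixP => A b; rewrite !mxE; ring.
rewrite upE dnE !ih //; apply/matrixP => A b; rewrite [RHS]mxE -[A]splitK.
case: (split A) => B; rewrite /unsplit.
  rewrite (unsplitK (inl B)) !col_mxEu !mxE /euler big_cons; ring.
rewrite (unsplitK (inr B)) !col_mxEd !mxE /euler big_cons mulrS; ring.
Qed.

Lemma euler_homog e p : homog_of_degree e p ->
  euler (enum 'I_n) p = p *~ e.
Proof.
move=> homp; rewrite /euler big_enum /=.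
transitivity (\sum_(i : 'I_n) \sum_(m <- msupp p)
    (p@_m * (m i)%:R) *: 'X_[F, m]).
  apply: eq_bigr => i _; rewrite [in LHS](mpolyE p) raddf_sum mulr_sumr.
  apply: eq_bigr => m _ /=; rewrite mderivZ mderivX -!scalerAr scalerA.
  have [m0|mi] := eqVneq (m i) 0%N; first by rewrite m0 mulr0 !scale0r.
  by rewrite -mpolyXD addmC submK // lep1mP.
rewrite exchange_big [in RHS](mpolyE p) -[_ *~ e]scaler_int scaler_sumr.
apply: eq_big_seq => m /homp <-; rewrite -scaler_suml -mulr_sumr -natr_sum.
by rewrite -mdegE scalerA mulrC.
Qed.

Hypothesis charF0 : [pchar F] =i pred0.

Lemma intr_neq0 (e : int) : e != 0 -> e%:~R != 0 :> F.
Proof.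
have nat0 d : (d.+1%:R == 0 :> F) = false by move/pcharf0P: charF0 => ->.
case: e => [[|d]|d] // _; rewrite ?NegzE ?mulrNz ?oppr_eq0 -pmulrn.
  by rewrite nat0.
by rewrite nat0.
Qed.

Local Notation K := (koszul (enum 'I_n)).
Local Notation kd := (@kdeg (enum 'I_n)).

(** Away from internal degree zero, Cartan's formula is a contracting homotopy
    after division by the degree. *)
Lemma koszul_exact q (e : 'I_q -> int) h (w : 'M[S]_(kdim (enum 'I_n), q)) :
  bicomp kd h e w = w -> K *m w = 0 ->
  (forall b, e b = 0 -> forall A, w A b = 0) ->
  exists w', bicomp kd h.+1 e w' = w' /\ w = K *m w'.
Proof.
move=> wh Kw w0.
pose w1 := de_rham w *m diag_mx (\row_b ((e b)%:~R^-1)%:MP).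
have Kw1 : w = K *m w1.
  rewrite /w1 mulmxA; have := koszul_homotopy w (enum_uniq 'I_n).
  rewrite Kw (_ : de_rham 0 = 0) ?add0r; last first.
    by apply: (addrI (de_rham 0)); rewrite -de_rhamD !addr0.
  move=> ->; apply/matrixP => A b; rewrite mul_mx_diag !mxE.
  have [eb0|eb0] := eqVneq (e b) 0.
    by rewrite !w0 // mul0rn addr0 /euler big1 ?mul0r // => i _;
      rewrite linear0 mulr0.
  have [nK homw] := (bicompP _ _ _ _).1 wh A b.
  rewrite (euler_homog homw); have [KA|/nK ->] := eqVneq (kd A) h; last first.
    by rewrite mul0rz mul0rn addr0 mul0r.
  rewrite KA [_ *+ h]pmulrn -mulrzDr subrK -[_ *~ e b]mulrzr.
  rewrite -mulrA -(rmorph_int (@mpolyC n F)) -rmorphM mulfV ?intr_neq0 //.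
  by rewrite rmorph1 mulr1.
exists (bicomp kd h.+1 e w1); rewrite bicomp_id; split=> //.
rewrite -bicomp_mull -?Kw1 //; first exact: koszul_homog.
exact: koszul_kdeg.
Qed.

(** In positive homological position and total degree zero, the entries have
    negative degree. *)
Lemma koszul_exact_pos q (e : 'I_q -> int) h w :
  bicomp kd h.+1 e w = w -> K *m w = 0 ->
  exists w', bicomp kd h.+2 e w' = w' /\ w = K *m w'.
Proof.
move=> wh Kw; apply: koszul_exact => // b eb A.
have [_] := (bicompP _ _ _ _).1 wh A b; rewrite eb sub0r => homw.
exact: (@homog_neg _ _ h).
Qed.

Lemma koszul_exact0 q (e : 'I_q -> int) w :
  bicomp kd 0 e w = w -> (forall A b, (w A b)@_(0%MM) = 0) ->
  exists w', bicomp kd 1 e w' = w' /\ w = K *m w'.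
Proof.
move=> wh wc; apply: koszul_exact => //.
  apply/matrixP => A b; rewrite !mxE big1 // => B _.
  have [kB|/eqP kB] := eqVneq (kd B) (kd A).+1; last first.
    by rewrite koszul_kdeg ?mul0r //; apply/eqP.
  have [-> //] := (bicompP _ _ _ _).1 wh B b; first by rewrite mulr0.
  by rewrite kB.
move=> b eb A; have [_] := (bicompP _ _ _ _).1 wh A b.
rewrite eb subr0 => /homog_of_degreeP hw; apply/mpolyP => m; rewrite mcoeff0.
rewrite -hw mcoeff_hcomp eqz_nat mdeg_eq0; case: eqP => // ->.
exact: wc.
Qed.

Lemma koszul_const q (w : 'M[S]_(kdim (enum 'I_n), q)) A b :
  ((K *m w) A b)@_(0%MM) = 0.
Proof.
rewrite mxE raddf_sum big1 // => B _ /=; rewrite (rmorphM (mcoeff 0%MM)) /=.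
suff -> : (K A B)@_(0%MM) = 0 by rewrite mul0r.
have /homog_of_degreeP <- := @koszul_homog (enum 'I_n) A B.
by rewrite mcoeff_hcomp mdeg0.
Qed.

End Koszul.

(** * Tor is computed by the Koszul complex *)

Section ConstantSubquotient.

Variables (F : fieldType) (n r : nat).
Local Notation S := {mpoly F[n]}.
Local Notation iota := (@mpolyC n F : {rmorphism F -> S}).

(** The residue field acts on constant vectors, which makes row spaces over [F]
    subspaces of a free module over the polynomial ring. *)
Definition const_row_space m (X : 'M[F]_(m, r)) (c : 'rV[S]_r) : Prop :=
  exists2 c0, (c0 <= X)%MS & c = map_mx (@mpolyC n F) c0.

Lemma lincomb_const d (x : 'rV[F]_d) (M : 'M[F]_(d, r)) :
  lincomb iota (fun i => x 0 i) (fun i => map_mx (@mpolyC n F) (row i M))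
  = map_mx (@mpolyC n F) (x *m M).
Proof.
apply/rowP => k; rewrite summxE !mxE raddf_sum; apply: eq_bigr => i _.
by rewrite !mxE /= rmorphM.
Qed.

Lemma map_mpolyC_inj m : injective (@map_mx _ _ (@mpolyC n F) m r).
Proof.
move=> u v uv; apply/matrixP => i j.
move/matrixP/(_ i j)/(congr1 (mcoeff 0%MM)): uv.
by rewrite !mxE !mcoeffC eqxx !mulr1.
Qed.

Lemma subspace_const_row_space m (X : 'M[F]_(m, r)) :
  subspace iota (const_row_space X).
Proof.
split=> [|c _ _ [u uX ->] [v vX ->]].
  by exists 0; rewrite ?sub0mx // map_mx0.
exists (c *: u + v); first by rewrite addmx_sub // scalemx_sub.
by apply/rowP => k; rewrite !mxE mpolyCD mpolyCM.
Qed.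

Lemma qdim_const_row_space m m' (X : 'M[F]_(m, r)) (Y : 'M[F]_(m', r)) :
  (Y <= X)%MS ->
  qdim iota (const_row_space X) (const_row_space Y) (\rank X - \rank Y).
Proof.
move=> YX; set D := (X :\: Y)%MS.
have rD : \rank D = (\rank X - \rank Y)%N.
  by rewrite -(mxrank_cap_compl X Y) (capmx_idPr YX) addKn.
rewrite -rD; exists (fun i => map_mx (@mpolyC n F) (row i (row_base D))); split.
- move=> i; exists (row i (row_base D)) => //.
  by rewrite (submx_trans (row_sub _ _)) // eq_row_base diffmxSl.
- move=> _ [c0 cX ->].
  have : (c0 <= D + X :&: Y)%MS by rewrite addsmx_diff_cap_eq.
  case/sub_addsmxP => -[u1 u2] /= c0E.
  have : (u1 *m D <= row_base D)%MS by rewrite eq_row_base submxMl.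
  case/submxP => x xE; exists (fun i => x 0 i); rewrite lincomb_const -xE.
  exists (u2 *m (X :&: Y)%MS); first by rewrite mulmx_sub // capmxSr.
  by rewrite c0E map_mxD addrC addKr.
- move=> c.
  rewrite (_ : lincomb _ _ _ = map_mx (@mpolyC n F) ((\row_i c i) *m row_base
    D));
    last first.
    by rewrite -lincomb_const; apply: eq_bigr => i _; rewrite mxE.
  case=> c0 c0Y /map_mpolyC_inj cE i.
  suff /rowP/(_ i) : \row_i c i = 0 :> 'rV[F]_(\rank D) by rewrite !mxE.
  apply: (row_free_inj (row_base_free D)); rewrite mul0mx; apply/eqP.
  rewrite -submx0 -(capmx_diff X Y) sub_capmx cE c0Y andbT -cE.
  by rewrite (submx_trans (submxMl _ _)) // eq_row_base.
Qed.

End ConstantSubquotient.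

Section TorKoszul.

Variables (F : fieldType) (n : nat) (charF0 : [pchar F] =i pred0).
Local Notation S := {mpoly F[n]}.
Local Notation iota := (@mpolyC n F : {rmorphism F -> S}).
Local Notation N := (kdim (enum 'I_n)).
Local Notation K := (koszul F (enum 'I_n)).
Local Notation kd := (@kdeg n (enum 'I_n)).

Variables (J : S -> Prop) (R : graded_free_resolution J) (j : int).

(** The augmentation is treated as one more differential, ending in the free
    module of rank one that contains [J]. *)
Definition rrank q : nat := if q is q'.+1 then grank R q' else 1%N.

Definition rdeg q : 'I_(rrank q) -> int :=
  match q return 'I_(rrank q) -> int with
  | 0 => fun=> 0
  | q'.+1 => fun a => @gdeg _ _ _ R q' a
  end.

Definition rdiff q : 'M[S]_(rrank q.+1, rrank q) :=
  match q return 'M[S]_(rrank q.+1, rrank q) with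
  | 0 => gaug R
  | q'.+1 => gdiff R q'
  end.

(** The strand of internal degree [j] has entries of degree [twist b], minus the
    homological position, at the basis vector [b]. *)
Definition twist q (b : 'I_(rrank q)) : int := j - rdeg b.

Local Notation comp h q := (@bicomp F n _ _ kd h (@twist q)).

Lemma rdiff_homog q a b : homog_of_degree (twist b - twist a) (rdiff q a b).
Proof.
have -> : twist b - twist a = rdeg a - rdeg b by rewrite /twist; ring.
case: q a b => [|q] a b /=; last exact: gdiff_homog.
by rewrite ord1 subr0; apply: gaug_homog.
Qed.

Lemma comp_rdiff h q r (kk : 'I_r -> nat) (u : 'M_(r, rrank q.+1)) :
  bicomp kk h (@twist q) (u *m rdiff q)
  = bicomp kk h (@twist q.+1) u *m rdiff q.
Proof. exact/bicomp_mulr/rdiff_homog. Qed.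

Lemma comp_koszul h q (w : 'M_(N, rrank q)) :
  comp h q (K *m w) = K *m comp h.+1 q w.
Proof.
by apply: bicomp_mull; [apply: koszul_homog | apply: koszul_kdeg].
Qed.

Lemma compB h q (u v : 'M_(N, rrank q)) :
  comp h q u = u -> comp h q v = v -> comp h q (u - v) = u - v.
Proof.
move=> hu hv; rewrite bicompD hu; congr (_ + _).
by rewrite -scaleN1r -mpolyC1 -mpolyCN bicompZ hv.
Qed.

Lemma rdiff_exact q r (u : 'M_(r, rrank q.+1)) :
  u *m rdiff q = 0 <-> exists v : 'M_(r, rrank q.+2), u = v *m rdiff q.+1.
Proof.
have ex (x : 'rV_(rrank q.+1)) :
    x *m rdiff q = 0 <-> exists v : 'rV_(rrank q.+2), x = v *m rdiff q.+1.
  by case: q x {u} => [|q] x; [apply: gexact0 | apply: gexactS].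
split=> [ud|[v ->]].
  have [v vP] : exists v : 'I_r -> 'rV_(rrank q.+2),
      forall i, row i u = v i *m rdiff q.+1.
    apply: (@fin_all_exists _ _ (fun i v => row i u = v *m rdiff q.+1)) => i.
    by apply/ex; rewrite -row_mul ud row0.
  exists (\matrix_i v i); apply/row_matrixP => i.
  by rewrite row_mul rowK vP.
by apply/row_matrixP => i; rewrite !row_mul row0; apply/ex; exists (row i v).
Qed.

Lemma rdiff_sqr q r (v : 'M_(r, rrank q.+2)) : v *m rdiff q.+1 *m rdiff q = 0.
Proof. by apply/rdiff_exact; exists v. Qed.

Definition in_image q (w : 'M[S]_(N, rrank q)) : Prop :=
  exists u : 'M_(N, rrank q.+1), w = u *m rdiff q.

Lemma lift_image h q (w : 'M_(N, rrank q)) : comp h q w = w -> in_image w ->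
  exists2 u, comp h q.+1 u = u & w = u *m rdiff q.
Proof.
move=> wh [u wE]; exists (comp h q.+1 u); first exact: bicomp_id.
by rewrite -comp_rdiff -wE wh.
Qed.

Lemma koszulK q (u : 'M[S]_(N, q)) : K *m (K *m u) = 0.
Proof. by rewrite mulmxA koszul_sqr mul0mx. Qed.

Lemma koszul_comp0 q (w : 'M_(N, rrank q)) : comp 0 q w = w -> K *m w = 0.
Proof.
move=> wh; apply/matrixP => A b; rewrite !mxE big1 // => B _.
have [kB|/eqP kB] := eqVneq (kd B) (kd A).+1; last first.
  by rewrite koszul_kdeg ?mul0r //; apply/eqP.
have [-> //] := (bicompP _ _ _ _).1 wh B b; first by rewrite mulr0.
by rewrite kB.
Qed.

(** The coefficients are in the image of [rdiff q], that is, in a module of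
    syzygies, or in [J] itself for [q = 0]. *)
Definition koszul_cycles h q (w : 'M[S]_(N, rrank q)) : Prop :=
  [/\ comp h q w = w, K *m w = 0 & in_image w].

Definition koszul_boundaries h q (w : 'M[S]_(N, rrank q)) : Prop :=
  exists v, [/\ comp h.+1 q v = v, in_image v & w = K *m v].

Lemma subspace_koszul_cycles h q : subspace iota (@koszul_cycles h q).
Proof.
split=> [|c u v [uh Ku [x ux]] [vh Kv [y vy]]].
  by split; rewrite ?bicomp0 ?mulmx0 //; exists 0; rewrite mul0mx.
split.
- by rewrite bicompD bicompZ uh vh.
- by rewrite mulmxDr -scalemxAr Ku Kv scaler0 addr0.
- by exists (c%:MP *: x + y); rewrite mulmxDl -scalemxAl -ux -vy.
Qed.

(** Dimension shifting: the connecting homomorphism of the short exact sequence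
    that expresses the image of [rdiff q] as the quotient of a free module by
    the image of [rdiff q.+1]. *)
Lemma koszul_shift h q d :
  qdim iota (@koszul_cycles h.+1 q.+1) (@koszul_boundaries h.+1 q.+1) d ->
  qdim iota (@koszul_cycles h.+2 q) (@koszul_boundaries h.+2 q) d.
Proof.
apply: (@qdim_correspondence _ _ _ _ _ _ _ _ _ (fun w w' =>
  exists u, [/\ comp h.+2 q.+1 u = u, u *m rdiff q = w' & K *m u = w])).
- exact: subspace_koszul_cycles.
- exact: subspace_koszul_cycles.
- by exists 0; rewrite bicomp0 mul0mx mulmx0.
- move=> c _ _ _ _ [x [xh <- <-]] [y [yh <- <-]].
  exists (c%:MP *: x + y); split.
  + by rewrite bicompD bicompZ xh yh.
  + by rewrite mulmxDl -scalemxAl.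
  + by rewrite mulmxDr -scalemxAr.
- move=> w [wh Kw [x wx]]; have [u [uh wu]] := koszul_exact_pos charF0 wh Kw.
  exists (u *m rdiff q); last by exists u.
  split; last by exists u.
    by rewrite comp_rdiff uh.
  by rewrite mulmxA -wu wx rdiff_sqr.
- move=> w' [wh Kw im]; have [u uh wu] := lift_image wh im.
  exists (K *m u); last by exists u.
  split; first by rewrite comp_koszul uh.
    exact: koszulK.
  by apply/rdiff_exact; rewrite -mulmxA -wu.
move=> w w' _ _ [u [uh <- <-]]; split=> [[v [vh [x vx] uv]]|[v' [vh im uv]]].
  have [|y [yh uvy]] := koszul_exact_pos charF0 (compB uh vh).
    by rewrite mulmxBr uv subrr.
  exists (y *m rdiff q); split; [by rewrite comp_rdiff yh | by exists y |].
  by rewrite mulmxA -uvy mulmxBl vx rdiff_sqr subr0.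
have [y yh vy] := lift_image vh im.
exists (u - K *m y); split.
- by apply: compB => //; rewrite comp_koszul yh.
- by apply/rdiff_exact; rewrite mulmxBl uv vy mulmxA subrr.
- by rewrite mulmxBr koszulK subr0.
Qed.

Lemma koszul_shifts h q d :
  qdim iota (@koszul_cycles h.+1 q) (@koszul_boundaries h.+1 q) d ->
  qdim iota (@koszul_cycles (h + q).+1 0) (@koszul_boundaries (h + q).+1 0) d.
Proof.
elim: q h => [|q ih] h; first by rewrite addn0.
by move/koszul_shift/ih; rewrite addSnnS.
Qed.

(** In what follows [A0] is the row of the exterior power of order zero, and
    [const_vec] reduces it modulo the variables. *)
Variables (A0 : 'I_N) (A0P : forall A, (kd A == 0%N) = (A == A0)).

Definition const_vec q (v : 'M[S]_(N, q)) : 'rV[F]_q :=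
  map_mx (mcoeff 0%MM) (row A0 v).

Definition const_lift q (c : 'rV[F]_q) : 'M[S]_(N, q) :=
  \matrix_(A, b) if A == A0 then (c 0 b)%:MP else 0.

Lemma const_vecK q (c : 'rV[F]_q) : const_vec (const_lift c) = c.
Proof. by apply/rowP => b; rewrite !mxE eqxx mcoeffC eqxx mulr1. Qed.

Lemma const_vecB q (u v : 'M_(N, q)) :
  const_vec (u - v) = const_vec u - const_vec v.
Proof. by apply/rowP => b; rewrite !mxE mcoeffB. Qed.

Lemma const_vecP q c (u v : 'M_(N, q)) :
  const_vec (c%:MP *: u + v) = c *: const_vec u + const_vec v.
Proof. by apply/rowP => b; rewrite !mxE mcoeffD mcoeffCM. Qed.

Lemma const_vec0 q : const_vec (0 : 'M_(N, q)) = 0.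
Proof. by apply/rowP => b; rewrite !mxE mcoeff0. Qed.

Lemma const_vec_koszul q (v : 'M_(N, q)) : const_vec (K *m v) = 0.
Proof. by apply/rowP => b; rewrite mxE mxE koszul_const mxE. Qed.

Lemma const_vec_mul q q' (v : 'M_(N, q)) (D : 'M_(q, q')) :
  const_vec (v *m D) = const_vec v *m map_mx (mcoeff 0%MM) D.
Proof.
apply/rowP => b; rewrite !mxE raddf_sum; apply: eq_bigr => a _ /=.
by rewrite (rmorphM (mcoeff 0%MM)) /= !mxE.
Qed.

Definition in_strand q (c : 'rV[F]_(rrank q)) : Prop :=
  forall b, c 0 b != 0 -> rdeg b = j.

Lemma const_vec_strand q (v : 'M_(N, rrank q)) :
  comp 0 q v = v -> in_strand (const_vec v).
Proof.
move=> vh b; rewrite !mxE.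
have [_ /homog_of_degreeP <-] := (bicompP _ _ _ _).1 vh A0 b.
rewrite mcoeff_hcomp mdeg0 subr0 /twist; case: ifP => [/eqP|_]; last first.
  by rewrite eqxx.
by move/esym/eqP; rewrite subr_eq0 => /eqP ->.
Qed.

Lemma const_lift_comp q (c : 'rV[F]_(rrank q)) :
  in_strand c -> comp 0 q (const_lift c) = const_lift c.
Proof.
move=> cs; apply/bicompP => A b; rewrite mxE A0P; case: eqP => _; last first.
  by split=> //; apply: homog0.
split=> //; rewrite subr0.
have [->|/cs cb] := eqVneq (c 0 b) 0; first by rewrite mpolyC0; apply: homog0.
rewrite /twist cb subrr; apply/homogE.
by rewrite -[_%:MP]mulr1 mul_mpolyC rpredZ // dhomog1.
Qed.

(** The form of [koszul_exact0] used below: in homological position zero only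
    the row [A0] can be nonzero. *)
Lemma koszul_exact_const q (v : 'M_(N, rrank q)) :
  comp 0 q v = v -> const_vec v = 0 ->
  exists2 y, comp 1 q y = y & v = K *m y.
Proof.
move=> vh vc; have [|y [yh vy]] := koszul_exact0 charF0 vh; last by exists y.
move=> A b; have [AA0|AA0] := eqVneq A A0.
  by rewrite AA0; move/rowP/(_ b): vc; rewrite !mxE.
have [-> ] := (bicompP _ _ _ _).1 vh A b; last by rewrite A0P.
by rewrite mcoeff0.
Qed.

Lemma strandP i m (c : 'M[F]_(m, grank R i)) :
  reflect (forall k b, c k b != 0 -> gdeg b = j) (c <= tor_strand R i j)%MS.
Proof.
apply: (iffP idP) => [/submxP[x ->] k b|cs].
  rewrite mul_mx_diag !mxE; have [//|_] := eqVneq (gdeg b) j.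
  by rewrite mulr0 eqxx.
apply/submxP; exists c; apply/matrixP => k b; rewrite mul_mx_diag !mxE.
case: (eqVneq (c k b) 0) => [->|/cs ->]; first by rewrite mul0r.
by rewrite eqxx mulr1.
Qed.

Lemma tor_boundariesP i (c : 'rV[F]_(grank R i)) :
  (c <= tor_boundaries R i j)%MS <->
  exists2 t, (t <= tor_strand R i.+1 j)%MS & c = t *m tor_diff R i.
Proof.
split=> [/submxP[x ->]|[t /submxP[x ->] ->]].
  by exists (x *m tor_strand R i.+1 j); rewrite ?submxMl // mulmxA.
by rewrite -mulmxA submxMl.
Qed.

(** The tensored differential is graded: an entry of [gdiff] with a nonzero
    constant coefficient has degree zero. *)
Lemma tor_diff_strand i (t : 'rV[F]_(grank R i.+1)) :
  (t <= tor_strand R i.+1 j)%MS -> (t *m tor_diff R i <= tor_strand R i j)%MS.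
Proof.
move=> /strandP ts; apply/strandP => k b; rewrite mxE => nz.
apply/eqP; apply: contraNT nz => bj; apply/eqP; rewrite big1 // => a _.
have [->|/ts aj] := eqVneq (t k a) 0; first by rewrite mul0r.
have /homog_of_degreeP := @gdiff_homog _ _ _ R i a b.
rewrite mxE => <-; rewrite mcoeff_hcomp mdeg0 aj eq_sym subr_eq0 eq_sym.
by rewrite (negbTE bj) /= mulr0.
Qed.

Lemma tor_diff_const i : tor_diff R i = map_mx (mcoeff 0%MM) (rdiff i.+1).
Proof. by []. Qed.

Lemma tor_boundaries_sub i :
  (tor_boundaries R i j <= tor_cycles R i j)%MS.
Proof.
apply/row_subP => k; set c := row k _.
have /tor_boundariesP[t ts ->] : (c <= tor_boundaries R i j)%MS by apply:
  row_sub.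
case: i k c t ts => [|i] k c t ts /=; first exact: tor_diff_strand.
rewrite sub_capmx tor_diff_strand //=; apply/sub_kermxP.
rewrite (tor_diff_const i.+1) (tor_diff_const i) -{1}[t]const_vecK.
by rewrite -!const_vec_mul rdiff_sqr const_vec0.
Qed.

Lemma qdim_tor i :
  qdim iota (const_row_space (n := n) (tor_cycles R i j))
    (const_row_space (n := n) (tor_boundaries R i j)) (tor_dim R i j).
Proof. exact/qdim_const_row_space/tor_boundaries_sub. Qed.

Lemma const_of_mul q (v : 'M_(N, rrank q.+2)) (t : 'rV[F]_(rrank q.+2)) :
  const_vec v = t -> const_vec (v *m rdiff q.+1) = t *m tor_diff R q.
Proof. by rewrite const_vec_mul => ->. Qed.

(** Both sides are the strand of [J] modulo the products of [J] with the
    variables: a generator of the resolution corresponds to its image in [J]. *)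
Lemma tor0_koszul d :
  qdim iota (const_row_space (n := n) (tor_cycles R 0 j))
    (const_row_space (n := n) (tor_boundaries R 0 j)) d ->
  qdim iota (@koszul_cycles 0 0) (@koszul_boundaries 0 0) d.
Proof.
apply: (@qdim_correspondence _ _ _ _ _ _ _ _ _ (fun c w =>
  exists v, [/\ comp 0 1 v = v, v *m rdiff 0 = w
              & c = map_mx (@mpolyC n F) (const_vec v)])).
- exact: subspace_const_row_space.
- exact: subspace_koszul_cycles.
- by exists 0; rewrite bicomp0 mul0mx const_vec0 map_mx0.
- move=> c _ _ _ _ [x [xh <- ->]] [y [yh <- ->]].
  exists (c%:MP *: x + y); split.
  + by rewrite bicompD bicompZ xh yh.
  + by rewrite mulmxDl -scalemxAl.
  + by rewrite const_vecP; apply/rowP => b; rewrite !mxE mpolyCD mpolyCM.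
- move=> _ [c /strandP cs ->].
  have vh : comp 0 1 (const_lift c) = const_lift c.
    by apply: (@const_lift_comp 1) => b; apply: cs.
  exists (const_lift c *m rdiff 0); last first.
    by exists (const_lift c); rewrite const_vecK.
  have wh : comp 0 0 (const_lift c *m rdiff 0) = const_lift c *m rdiff 0.
    by rewrite comp_rdiff vh.
  by split=> //; [apply: koszul_comp0 | exists (const_lift c)].
- move=> w [wh _ im]; have [v vh wv] := lift_image wh im.
  exists (map_mx (@mpolyC n F) (const_vec v)); last by exists v.
  exists (const_vec v) => //; apply/strandP => k b; rewrite ord1.
  exact: (const_vec_strand (q := 1) vh).
move=> _ _ _ _ [v [vh <- ->]]; split.
  case=> c /tor_boundariesP[t /strandP ts ->] /map_mpolyC_inj vt.
  have th : comp 0 2 (const_lift t) = const_lift t.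
    by apply: (@const_lift_comp 2) => b; apply: ts.
  have [||y yh vy] := @koszul_exact_const 1 (v - const_lift t *m rdiff 1).
  + by apply: compB => //; rewrite comp_rdiff th.
  + by rewrite const_vecB (const_of_mul (const_vecK t)) vt subrr.
  exists (y *m rdiff 0); split; [by rewrite comp_rdiff yh | by exists y |].
  by rewrite mulmxA -vy mulmxBl rdiff_sqr subr0.
case=> z [zh im vz]; have [y yh zy] := lift_image zh im.
have im1 : in_image (v - K *m y).
  by apply/rdiff_exact; rewrite mulmxBl vz zy mulmxA subrr.
have [t th vt] : exists2 t, comp 0 2 t = t & v - K *m y = t *m rdiff 1.
  by apply: lift_image im1; apply: compB => //; rewrite comp_koszul yh.
exists (const_vec v) => //; apply/tor_boundariesP; exists (const_vec t).
  by apply/strandP => k b; rewrite ord1; apply: (const_vec_strand (q := 2) th).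
rewrite -(const_of_mul (erefl (const_vec t))) -vt const_vecB const_vec_koszul.
by rewrite subr0.
Qed.

(** The end of the zigzag in the double complex of the Koszul complex and the
    resolution: a constant cycle [c] is lifted to [v], its image is a Koszul
    boundary [K *m u], and [u] is mapped to the Koszul cycle [w]. *)
Lemma torS_koszul q d :
  qdim iota (const_row_space (n := n) (tor_cycles R q.+1 j))
    (const_row_space (n := n) (tor_boundaries R q.+1 j)) d ->
  qdim iota (@koszul_cycles 1 q) (@koszul_boundaries 1 q) d.
Proof.
apply: (@qdim_correspondence _ _ _ _ _ _ _ _ _ (fun c w =>
  exists u v, [/\ comp 1 q.+1 u = u, u *m rdiff q = w, comp 0 q.+2 v = v,
                  v *m rdiff q.+1 = K *m u
                & c = map_mx (@mpolyC n F) (const_vec v)])).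
- exact: subspace_const_row_space.
- exact: subspace_koszul_cycles.
- by exists 0, 0; rewrite !bicomp0 !mul0mx mulmx0 const_vec0 map_mx0.
- move=> c _ _ _ _ [x [x' [xh <- xh' xx' ->]]] [y [y' [yh <- yh' yy' ->]]].
  exists (c%:MP *: x + y), (c%:MP *: x' + y'); split.
  + by rewrite bicompD bicompZ xh yh.
  + by rewrite mulmxDl -scalemxAl.
  + by rewrite bicompD bicompZ xh' yh'.
  + by rewrite mulmxDl -scalemxAl mulmxDr -scalemxAr xx' yy'.
  + by rewrite const_vecP; apply/rowP => b; rewrite !mxE mpolyCD mpolyCM.
- move=> _ [c cyc ->]; move: cyc; rewrite sub_capmx => /andP[/strandP cs ck].
  set v := const_lift c.
  have vh : comp 0 q.+2 v = v.
    by apply: (@const_lift_comp q.+2) => b; apply: cs.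
  have [||u uh vu] := @koszul_exact_const q.+1 (v *m rdiff q.+1).
  + by rewrite comp_rdiff vh.
  + by rewrite (const_of_mul (const_vecK c)); apply/sub_kermxP.
  exists (u *m rdiff q); last by exists u, v; rewrite const_vecK.
  split; [by rewrite comp_rdiff uh | | by exists u].
  by rewrite mulmxA -vu rdiff_sqr.
- move=> w [wh Kw im]; have [u uh wu] := lift_image wh im.
  have [v vh vu] : exists2 v, comp 0 q.+2 v = v & K *m u = v *m rdiff q.+1.
    apply: lift_image; first by rewrite comp_koszul uh.
    by apply/rdiff_exact; rewrite -mulmxA -wu.
  exists (map_mx (@mpolyC n F) (const_vec v)); last by exists u, v.
  exists (const_vec v) => //; rewrite sub_capmx; apply/andP; split.
    apply/strandP => k b; rewrite ord1.
    exact: (const_vec_strand (q := q.+2) vh).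
  apply/sub_kermxP; rewrite -(const_of_mul (erefl (const_vec v))) -vu.
  exact: const_vec_koszul.
move=> _ _ _ _ [u [v [uh <- vh vu ->]]]; split.
  case=> c /tor_boundariesP[t /strandP ts ->] /map_mpolyC_inj vt.
  have th : comp 0 q.+3 (const_lift t) = const_lift t.
    by apply: (@const_lift_comp q.+3) => b; apply: ts.
  have [||y yh vy] := @koszul_exact_const q.+2 (v - const_lift t *m rdiff q.+2).
  + by apply: compB => //; rewrite comp_rdiff th.
  + by rewrite const_vecB (const_of_mul (const_vecK t)) vt subrr.
  have [||z [zh uz]] := @koszul_exact_pos _ _ charF0 _ (@twist q.+1) 0 (u - y
    *m rdiff q.+1).
  + by apply: compB => //; rewrite comp_rdiff yh.
  + by rewrite mulmxBr -vu mulmxA -vy mulmxBl rdiff_sqr subr0 subrr.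
  exists (z *m rdiff q); split; [by rewrite comp_rdiff zh | by exists z |].
  by rewrite mulmxA -uz mulmxBl rdiff_sqr subr0.
case=> z [zh im uz]; have [x xh zx] := lift_image zh im.
have [y yh uy] : exists2 y, comp 1 q.+2 y = y & u - K *m x = y *m rdiff q.+1.
  apply: lift_image; first by apply: compB => //; rewrite comp_koszul xh.
  by apply/rdiff_exact; rewrite mulmxBl uz zx mulmxA subrr.
have [t th vt] : exists2 t, comp 0 q.+3 t = t & v - K *m y = t *m rdiff q.+2.
  apply: lift_image; first by apply: compB => //; rewrite comp_koszul yh.
  apply/rdiff_exact; rewrite mulmxBl vu -mulmxA -uy mulmxBr koszulK subr0.
  by rewrite subrr.
exists (const_vec v) => //; apply/tor_boundariesP; exists (const_vec t).
  by apply/strandP => k b; rewrite ord1;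
    apply: (const_vec_strand (q := q.+3) th).
rewrite -(const_of_mul (erefl (const_vec t))) -vt const_vecB const_vec_koszul.
by rewrite subr0.
Qed.

End TorKoszul.

Section IdealKoszul.

Variables (F : fieldType) (n : nat).
Local Notation S := {mpoly F[n]}.
Local Notation iota := (@mpolyC n F : {rmorphism F -> S}).
Local Notation N := (kdim (enum 'I_n)).
Local Notation K := (koszul F (enum 'I_n)).
Local Notation kd := (@kdeg n (enum 'I_n)).

Definition koszul_chains (J : S -> Prop) (h : nat) (j : int) (w : 'cV[S]_N) :
    Prop :=
  bicomp kd h (fun=> j) w = w /\ forall A, J (w A 0).

Definition ideal_cycles J h j w : Prop := koszul_chains J h j w /\ K *m w = 0.

Definition ideal_boundaries J h j w : Prop :=
  exists2 v, koszul_chains J h.+1 j v & w = K *m v.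

(** The Koszul subquotient does not mention the resolution: in particular Tor is
    independent of it, and it can be computed uniformly for all powers of an
    ideal. *)
Theorem tor_dim_koszul (charF0 : [pchar F] =i pred0) (J : S -> Prop)
    (R : graded_free_resolution J) (h : nat) (j : int) :
  qdim iota (ideal_cycles J h j) (ideal_boundaries J h j) (tor_dim R h j).
Proof.
have [A0 A0P] := kdeg0_unique (enum 'I_n).
have imP (w : 'cV[S]_N) : in_image (R := R) (q := 0) w <-> forall A, J (w A 0).
  split=> [[u ->] A|wJ].
    apply/(gaug_onto R); exists (row A u).
    by rewrite -row_mul [RHS]mxE.
  have [u uP] : exists u : 'I_N -> 'rV[S]_(grank R 0),
      forall A, w A 0 = (u A *m gaug R) 0 0.
    apply: (@fin_all_exists _ _ (fun A x => w A 0 = (x *m gaug R) 0 0)) => A.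
    exact/(gaug_onto R).
  exists (\matrix_A u A); apply/matrixP => A b; rewrite ord1 uP.
  have -> : u A = row A (\matrix_A u A) by rewrite rowK.
  by rewrite -row_mul mxE.
have compE q (w : 'cV[S]_N) :
    bicomp kd q (@twist _ _ _ R j 0) w = bicomp kd q (fun=> j) w.
  by apply/matrixP => A b; rewrite !mxE /twist subr0.
have main : qdim iota (@koszul_cycles F n J R j h 0)
    (@koszul_boundaries F n J R j h 0) (tor_dim R h j).
  case: h => [|h].
    exact/(tor0_koszul charF0 A0P)/qdim_tor.
  rewrite -[h.+1]/(0 + h).+1.
  exact/(koszul_shifts charF0)/(torS_koszul charF0 A0P)/qdim_tor.
apply: qdim_ext main.
- move=> w; rewrite /koszul_cycles compE; split.
    by move=> [wh Kw /imP wJ].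
  by move=> [[wh /imP wJ] Kw].
- move=> w _; split=> [[v [vh /imP vJ wv]]|[v [vh /imP vJ] wv]].
    by exists v => //; split=> //; rewrite -compE.
  by exists v; split=> //; rewrite compE.
- exact: subspace_koszul_cycles.
Qed.

End IdealKoszul.

(** * Betti numbers of powers *)

Section Powers.

Variables (F : fieldType) (n : nat).
Local Notation S := {mpoly F[n]}.
Local Notation iota := (@mpolyC n F : {rmorphism F -> S}).
Local Notation N := (kdim (enum 'I_n)).
Local Notation K := (koszul F (enum 'I_n)).
Local Notation kd := (@kdeg n (enum 'I_n)).

Lemma ideal_spanP (A : comNzRingType) (gs : seq A) (p : A) :
  ideal_span gs p <->
  @span A A idfun A^o (fun x => x \in gs) p.
Proof.
split=> [[c ->]|].
  apply: (@span_sum _ _ _ A^o) => i _.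
  apply: (@spanZ _ _ (idfun : {rmorphism A -> A}) A^o).
  by apply: span_in; apply: mem_nth.
elim=> [|c x v xg _ [cv ->]].
  by exists (fun=> 0); rewrite big1 // => i _; rewrite mul0r.
have ix : (index x gs < size gs)%N by rewrite index_mem.
exists (fun i => (if i == Ordinal ix then c else 0) + cv i).
under [RHS]eq_bigr do rewrite mulrDl.
rewrite big_split /=; congr (_ + _).
rewrite (bigD1 (Ordinal ix)) //= eqxx nth_index // big1 ?addr0 // => i.
by move/negbTE => ->; rewrite mul0r.
Qed.

Variables (r : nat) (gs : seq S) (I : S -> Prop).
Hypothesis gs_homog : forall g, g \in gs -> g \is r.-homog.
Hypothesis Igs : forall p, I p <-> ideal_span gs p.

Local Notation m := (size gs).
Local Notation g := (fun i : 'I_(size gs) => gs`_i).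

Definition gen_power (k : nat) (x : S) : Prop :=
  exists e : 'X_{1..m}, mdeg e = k /\ x = mmap1 g e.

Lemma mmap1_gD e f : mmap1 g (e + f)%MM = mmap1 g e * mmap1 g f.
Proof. by rewrite commr_mmap1_M // => i x; apply: mulrC. Qed.

(** The power of degree [k] is the part of degree [k] of the Rees algebra, which
    is generated over the polynomial ring by the monomials in the generators. *)
Lemma ideal_expP k p :
  ideal_exp I k p <-> @span S S idfun S^o (gen_power k) p.
Proof.
elim: k p => [|k ih] p.
  split=> // _; rewrite -[p]mulr1 -(mmap11 g) -[X in _ X]addr0.
  apply: (@span_cons _ _ (idfun : {rmorphism S -> S}) S^o); last first.
    exact: span_nil.
  by exists 0%MM; rewrite mdeg0.
have mulg q i : @span S S idfun S^o (gen_power k) q ->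
    @span S S idfun S^o (gen_power k.+1) (q * gs`_i) \/ (m <= i)%N.
  have [|im] := leqP m i; [by right | move=> qk; left].
  elim: qk => [|c x v [e [ek ->]] _ ihv]; first by rewrite mul0r;
    apply: span_nil.
  rewrite mulrDl -[_ *: _]/(c * _) -mulrA.
  apply: (@span_cons _ _ (idfun : {rmorphism S -> S}) S^o) => //.
  exists (e + U_(Ordinal im))%MM; rewrite mdegD mdeg1 addn1 ek; split=> //.
  by rewrite mmap1_gD mmap1U.
split=> [[s [sI ->]]|].
  rewrite big_seq; apply: (@span_sum _ _ _ S^o) => q /sI[/ih q1 /Igs[c ->]].
  rewrite mulr_sumr; apply: (@span_sum _ _ _ S^o) => i _.
  rewrite mulrCA; apply: (@spanZ _ _ (idfun : {rmorphism S -> S}) S^o).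
  by case: (mulg q.1 i q1) => //; rewrite leqNgt ltn_ord.
elim=> [|c x v [e [ek ->]] _ [s [sI ->]]].
  by exists [::]; split=> //; rewrite big_nil.
have [i ei] : exists i, (e i != 0)%N.
  apply/existsP; apply: contraT; rewrite negb_exists => /forallP e0.
  move: ek; rewrite mdegE big1 // => i _; apply/eqP.
  by have := e0 i; rewrite negbK.
have eE : e = ((e - U_(i)) + U_(i))%MM by rewrite submK // lep1mP.
exists ((c * mmap1 g (e - U_(i))%MM, gs`_i) :: s); split; last first.
  by rewrite big_cons /= {1}eE mmap1_gD mmap1U -mulrA.
move=> q; rewrite inE => /predU1P[->|/sI //]; split => /=.
  apply/ih; apply: (@spanZ _ _ (idfun : {rmorphism S -> S}) S^o).
  apply: span_in; exists (e - U_(i))%MM; split=> //.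
  by apply/eqP; rewrite -eqSS -ek {2}eE mdegD mdeg1 addn1.
apply/Igs/ideal_spanP; apply: (@span_in _ _ (idfun : {rmorphism S -> S}) S^o).
exact: mem_nth.
Qed.

Lemma gen_power_homog k x : gen_power k x -> homog_of_degree (r * k)%N%:Z x.
Proof.
case=> e [<- ->]; apply/homogE; rewrite mdegE big_distrr /= /mmap1.
elim/big_ind2: _ => [|x1 d1 x2 d2|i _]; first exact: dhomog1.
  exact: dhomogM.
by apply/dhomogMn/gs_homog/mem_nth.
Qed.

Lemma ideal_exp_submodule k : @submodule S S^o (ideal_exp I k).
Proof.
have [s0 sl] := @submodule_span S S^o (gen_power k).
split=> [|c u v /ideal_expP uk /ideal_expP vk]; apply/ideal_expP => //.
exact: sl.
Qed.

Lemma power_resolution_exists k :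
  inhabited (graded_free_resolution (ideal_exp I k)).
Proof.
pose l := [seq mmap1 g (bmnm e) 
  | e <- enum {: 'X_{1..m < k.+1}} & mdeg (bmnm e) == k].
have lP x : x \in l <-> gen_power k x.
  split=> [/mapP[e]|[e [ek ->]]].
    by rewrite mem_filter => /andP[/eqP ek _] ->; exists (bmnm e).
  have ek' : (mdeg e < k.+1)%N by rewrite ek.
  apply/mapP; exists (BMultinom ek') => //.
  by rewrite mem_filter mem_enum /= ek eqxx.
apply: (@graded_free_resolution_exists _ _ _ (r * k) l).
  by move=> x /lP /gen_power_homog /homogE.
move=> p; split=> [/ideal_expP|/ideal_spanP] pk.
  apply/ideal_spanP; apply: (@span_span _ _ (idfun : {rmorphism S -> S}) S^o)
    pk => x /lP; apply: span_in.
apply/ideal_expP; apply: (@span_span _ _ (idfun : {rmorphism S -> S}) S^o)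
  pk => x /lP; apply: span_in.
Qed.

Section Strand.

(** In the strand of internal degree [r * k + j], the chains at homological
    position [h] are the span of the products of a monomial of degree [k] in
    the generators with one of the vectors [chain_gen], which do not depend on
    [k]: the nonzero ones are a basis of the strand of degree [j] for the unit
    ideal. *)
Variables (h : nat) (j : int).

Local Notation T := ('I_N * 'X_{1..n < `|j|.+1})%type.

Definition chain_gen (i : 'I_#|{: T}|) : 'cV[S]_N :=
  let t := enum_val i in
  if (kd t.1 == h) && ((mdeg t.2)%:Z == j - h%:Z)
  then 'X_[bmnm t.2] *: delta_mx t.1 0 else 0.

Lemma koszul_chains_subspace J jj : @submodule S S^o J ->
  subspace iota (@koszul_chains F n J h jj).
Proof.
move=> [J0 Jl]; split=> [|c u v [uh uJ] [vh vJ]].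
  by split=> [|A]; rewrite ?bicomp0 ?mxE.
split=> [|A]; first by rewrite bicompD bicompZ uh vh.
by rewrite !mxE; apply: Jl.
Qed.

Lemma koszul_chains_span k w :
  koszul_chains (ideal_exp I k) h ((r * k)%N%:Z + j) w <->
  span iota (degree_part g chain_gen k) w.
Proof.
split=> [[wh wI]|]; last first.
  have sub := koszul_chains_subspace ((r * k)%N%:Z + j) (ideal_exp_submodule k).
  apply: span_min; first exact: sub.1.
    by move=> u v; apply: (subspaceD sub).
  move=> c _ [a [e [ek ->]]]; apply: (subspaceZ _ sub).
  rewrite /monomial_vector /chain_gen; case: ifP; last by rewrite scaler0;
    case: sub.
  case/andP=> /eqP kdh /eqP degj; have ge : gen_power k (mmap1 g e) by exists e.
  split=> [|A].
    apply/bicompP => A b; rewrite !mxE; have [->|_] := eqVneq A (enum_val a).1;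
      last by rewrite /= !mulr0; split=> //; apply: homog0.
    rewrite kdh eqxx; split=> //; rewrite ord1 eqxx mulr1.
    apply/homog_of_degreeP; rewrite mulrC (hcompM _ _ (gen_power_homog ge)).
    rewrite hcompX degj [_ + j]addrC addrAC addrK eqxx.
    by rewrite mulrC.
  rewrite !mxE mulrC; apply/ideal_expP.
  by apply: (@spanZ _ _ (idfun : {rmorphism S -> S}) S^o); apply: span_in.
have -> : w = \sum_A w A 0 *: delta_mx A 0.
  apply/matrixP => A b; rewrite ord1 summxE (bigD1 A) //= big1 => [|B ne].
    by rewrite !mxE !eqxx mulr1 addr0.
  by rewrite !mxE eq_sym (negbTE ne) mulr0.
apply: span_sum => A _.
have [kdh|/eqP kdh] := eqVneq (kd A) h; last first.
  have [wA _] := (bicompP _ _ _ _).1 wh A 0.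
  by rewrite wA ?scale0r; [apply: span_nil | apply/eqP].
have [_ /homog_of_degreeP <-] := (bicompP _ _ _ _).1 wh A 0.
move/ideal_expP: (wI A); move: (w A 0) => p; elim=> [|c x v xk _ ihv].
  by rewrite raddf0 scale0r; apply: span_nil.
rewrite raddfD scalerDl; apply: spanD ihv.
rewrite /= -[c *: x]/(c * x) (hcompM _ _ (gen_power_homog xk)).
rewrite [_ + j]addrC addrAC addrK.
case: xk => e [ek ->]; rewrite [hcomp _ c]mpolyE mulr_suml scaler_suml.
rewrite big_seq; apply: span_sum => f fsupp.
have fdeg : (mdeg f)%:Z = j - h%:Z by apply: (@hcomp_homog _ _ _ c).
have fD : (mdeg f < `|j|.+1)%N by lia.
rewrite -mul_mpolyC -mulrA -scalerA mulrC -scalerA; apply: spanZ;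
  apply: span_in.
exists (enum_rank (A, BMultinom fD)), e; split=> //.
by rewrite /monomial_vector /chain_gen enum_rankK /= kdh fdeg !eqxx.
Qed.

(** The image of the Koszul differential is again generated over the polynomial
    ring in the generators of the ideal by vectors that do not depend on [k]. *)
Lemma koszul_image_span k u :
  (exists2 w, koszul_chains (ideal_exp I k) h ((r * k)%N%:Z + j) w & u = K *m w)
  <-> span iota (degree_part g (fun i => K *m chain_gen i) k) u.
Proof.
split=> [[w /koszul_chains_span wk ->]|uk].
  elim: wk => [|c x v [a [e [ek ->]]] _ ih]; first by rewrite mulmx0;
    apply: span_nil.
  rewrite mulmxDr -scalemxAr; apply: span_cons => //.
  by exists a, e; rewrite /monomial_vector -scalemxAr.
suff [w wk ->] : exists2 w,
    span iota (degree_part g chain_gen k) w & u = K *m w.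
  by exists w => //; apply/koszul_chains_span.
elim: uk => [|c x v [a [e [ek ->]]] _ [w wk ->]].
  by exists 0; [apply: span_nil | rewrite mulmx0].
exists (c%:MP *: monomial_vector g chain_gen a e + w).
  by apply: span_cons => //; exists a, e.
by rewrite mulmxDr -scalemxAr /monomial_vector -scalemxAr.
Qed.

Lemma chains_hilbert : exists c, eventually_polynomial (fun k => (c k)%:R) /\
  forall k, qdim iota (koszul_chains (ideal_exp I k) h ((r * k)%N%:Z + j))
    (fun w => w = 0) (c k).
Proof.
have [c [cP cdim]] := degree_part_hilbert_polynomial iota g chain_gen.
exists c; split=> // k; apply: qdim_ext (cdim k) => // [w|].
  by split=> /koszul_chains_span.
exact: subspace_span.
Qed.

Lemma image_hilbert : exists c, eventually_polynomial (fun k => (c k)%:R) /\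
  forall k, qdim iota
    (fun u => exists2 w, koszul_chains (ideal_exp I k) h ((r * k)%N%:Z + j) w
                         & u = K *m w)
    (fun w => w = 0) (c k).
Proof.
have [c [cP cdim]] :=
  degree_part_hilbert_polynomial iota g (fun i => K *m chain_gen i).
exists c; split=> // k; apply: qdim_ext (cdim k) => // [w|].
  by split=> /koszul_image_span.
exact: subspace_span.
Qed.

End Strand.

(** First isomorphism theorem for the Koszul differential, whose graph is the
    correspondence. *)
Lemma qdim_chains_cycles J h jj d : @submodule S S^o J ->
  qdim iota (fun u => exists2 w, koszul_chains J h jj w & u = K *m w)
    (fun u => u = 0) d ->
  qdim iota (koszul_chains J h jj) (ideal_cycles J h jj) d.
Proof.
move=> sJ;
  apply: (@qdim_correspondence _ _ _ _ _ _ _ _ _ (fun u w => u = K *m w)).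
- split=> [|c _ _ [u uh ->] [v vh ->]].
    by exists 0; [case: (koszul_chains_subspace h jj sJ) | rewrite mulmx0].
  exists (c%:MP *: u + v); first by apply: (koszul_chains_subspace h jj sJ).2.
  by rewrite mulmxDr -scalemxAr.
- exact: koszul_chains_subspace.
- by rewrite mulmx0.
- by move=> c _ u _ v -> ->; rewrite mulmxDr -scalemxAr.
- by move=> _ [w wh ->]; exists w.
- by move=> w wh; exists (K *m w) => //; exists w.
- move=> _ w _ wh ->; split=> [Kw|[]//]; by split.
Qed.

Lemma boundaries_sub_cycles J h jj w : @submodule S S^o J ->
  ideal_boundaries J h jj w -> ideal_cycles J h jj w.
Proof.
move=> [J0 Jl] [v [vh vJ] ->]; split; last by rewrite mulmxA koszul_sqr mul0mx.
split=> [|A].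
  rewrite (@bicomp_mull _ _ _ _ kd h (fun=> jj)) ?vh //;
    first exact: koszul_homog.
  exact: koszul_kdeg.
rewrite mxE; elim/big_ind: _ => // [x y Jx Jy|B _].
  by rewrite -[x]mul1r; apply: Jl.
by rewrite -[_ * _]addr0; apply: Jl.
Qed.

(** Chains modulo cycles are isomorphic to boundaries one position below, so a
    Betti number is the dimension [c] of the chains minus the dimensions [a] and
    [b] of two images of the Koszul differential. *)
Theorem betti_eventually_polynomial (charF0 : [pchar F] =i pred0) h j :
  eventually_polynomial
    (fun k => (betti (ideal_exp I k) h ((r * k)%N%:Z + j))%:R).
Proof.
have [c [cP cdim]] := chains_hilbert h j.
have [a [aP adim]] := image_hilbert h j.
have [b [bP bdim]] := image_hilbert h.+1 j.
have key k : (c k = b k + betti (ideal_exp I k) h ((r * k)%N%:Z + j) + a k)%N.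
  have sJ := ideal_exp_submodule k.
  have [R ->] : exists R : graded_free_resolution (ideal_exp I k),
      betti (ideal_exp I k) h ((r * k)%N%:Z + j)
      = tor_dim R h ((r * k)%N%:Z + j).
    apply: (@epsilon_spec _ _ (fun b => exists R :
      graded_free_resolution (ideal_exp I k), b = tor_dim R h _)).
    by have [R] := power_resolution_exists k; eexists; exists R.
  have tdim := tor_dim_koszul charF0 R h ((r * k)%N%:Z + j).
  have csub : subspace iota (ideal_cycles (ideal_exp I k) h ((r * k)%N%:Z + j)).
    have [s0 sl] := koszul_chains_subspace h ((r * k)%N%:Z + j) sJ.
    split=> [|x u v [uh Ku] [vh Kv]]; first by split=> //; rewrite mulmx0.
    by split; [apply: sl | rewrite mulmxDr -scalemxAr Ku Kv scaler0 addr0].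
  have bsub : subspace iota (ideal_boundaries (ideal_exp I k) h ((r * k)%N%:Z
    + j)).
    have [s0 sl] := koszul_chains_subspace h.+1 ((r * k)%N%:Z + j) sJ.
    split=> [|x _ _ [u uh ->] [v vh ->]]; first by exists 0; rewrite ?mulmx0.
    by exists (x%:MP *: u + v); [apply: sl | rewrite mulmxDr -scalemxAr].
  apply: (qdim_uniq (subspace0 iota _) (cdim k)).
  apply: (qdimD (B := ideal_cycles (ideal_exp I k) h ((r * k)%N%:Z + j))) => //.
  - by move=> _ ->; case: csub.
  - by move=> w [].
  - apply: (qdimD (B := ideal_boundaries (ideal_exp I k) h ((r * k)%N%:Z +
    j))) => //.
    + by move=> _ ->; case: bsub.
    + by move=> w; apply: boundaries_sub_cycles.
    + exact: bdim.
  - exact: (qdim_chains_cycles sJ (adim k)).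
apply: (@eventually_polynomial_ext
  (fun k => (c k)%:R + -1 * ((b k)%:R + (a k)%:R)) _ 0).
  by move=> k _; rewrite key !natrD; ring.
exact/eventually_polynomialD/eventually_polynomialZ/eventually_polynomialD.
Qed.

End Powers.

(** * Maximal chains of pure diagrams span the window *)

Section MaximalChain.

Variables (n : nat) (M N' : int) (l : nat) (e : 'I_l.+1 -> seq int).
Hypothesis e_lt : forall m m' : 'I_l.+1, (m < m')%N -> pure_lt (e m) (e m').
Hypothesis e_max : maximal_pure_chain n M N' (fun d => exists m, d = e m).

Lemma pure_le_trans b a c : pure_le a b -> pure_le b c -> pure_le a c.
Proof.
move=> [sab ab] [sbc bc]; split=> [|i ic]; first exact: leq_trans sab.
by apply: le_trans (bc i ic); apply: ab; apply: leq_trans ic sbc.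
Qed.

Lemma pure_le_anti a b : pure_le a b -> pure_le b a -> a = b.
Proof.
move=> [sab ab] [sba ba].
have sE : size a = size b by apply/eqP; rewrite eqn_leq sab sba.
apply: (@eq_from_nth _ 0) => // i ia; apply: le_anti.
by rewrite ab ?ba // -sE.
Qed.

Lemma e_le (m m' : 'I_l.+1) : (m <= m')%N -> pure_le (e m) (e m').
Proof.
by rewrite leq_eqVlt => /predU1P[/val_inj ->|/e_lt[]//].
Qed.

Lemma e_window m : pure_in_window n M N' (e m).
Proof. by apply: e_max.1.1; exists m. Qed.

Lemma e_sorted m i i' : (i < i')%N -> (i' < size (e m))%N ->
  (e m)`_i < (e m)`_i'.
Proof. by have [[_ sorted] _ _] := e_window m; apply: sorted. Qed.

Lemma comparable_member f : pure_in_window n M N' f ->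
  (forall m, pure_le (e m) f \/ pure_le f (e m)) -> exists m, f = e m.
Proof.
move=> fw fcomp; apply: (e_max.2 (fun d => (exists m, d = e m) \/ d = f)).
- split=> [d [[m ->]|->] //|]; first exact: e_window.
  move=> d d' [[m ->]|->] [[m' ->]|->]; last by left.
  + exact: e_max.1.2 (ex_intro _ m erefl) (ex_intro _ m' erefl).
  + exact: fcomp.
  + by case: (fcomp m'); [right | left].
- by move=> d de; left.
- by right.
Qed.

(** The support of the pure diagram of [d]. Along a chain, a position that has
    been left is never covered again. *)
Definition covers (d : seq int) (i : nat) (j : int) : bool :=
  (i < size d)%N && (j == d`_i).

Lemma nth_splice i (a b : seq int) p : (i <= size a)%N ->
  (take i a ++ b)`_p = if (p < i)%N then a`_p else b`_(p - i).
Proof.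
move=> ia; rewrite nth_cat size_takel //.
by case: ifP => // pi; rewrite nth_take.
Qed.

(** If no member passed through the position [(i, j)], then joining the last
    member below it to the first member above it, through that position, would
    give a degree sequence comparable to the whole chain. *)
Lemma position_covered i j : (i <= n)%N -> M + i%:Z <= j <= N' + i%:Z ->
  exists m, covers (e m) i j.
Proof.
move=> iN /andP[Mj jN]; apply: Classical_Prop.NNPP => nocov.
pose low (m : 'I_l.+1) := (i < size (e m))%N && ((e m)`_i < j).
have upP m : ~~ low m -> (i < size (e m))%N -> j < (e m)`_i.
  rewrite /low => nl im; move: nl; rewrite im /= -leNgt le_eqVlt.
  by case/predU1P=> // jE; case: nocov; exists m; rewrite /covers im jE eqxx.
have lowup (m m' : 'I_l.+1) : low m -> ~~ low m' -> (m < m')%N.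
  move=> lm um'; rewrite ltnNge; apply/negP => /e_le[sz le].
  case/andP: lm => im mj; have im' := leq_trans im sz.
  have := lt_trans (upP _ um' im') (le_lt_trans (le _ im) mj).
  by rewrite ltxx.
have [A [[iA Asort Awin Aj] [AL AU]]] : exists A : seq int,
    [/\ (i < size A)%N,
        forall p p', (p < p')%N -> (p' <= i)%N -> A`_p < A`_p',
        forall p, (p <= i)%N -> M + p%:Z <= A`_p <= N' + p%:Z
      & A`_i <= j] /\
    (forall m, low m -> forall p, (p < i)%N -> (e m)`_p <= A`_p) /\
    (forall m, ~~ low m -> forall p, (p < i)%N -> (p < size (e m))%N ->
       A`_p <= (e m)`_p).
  have [m0 lm0|nolow] := pickP low; last first.
    exists (mkseq (fun p => M + p%:Z) i.+1); split; [split | split].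
    - by rewrite size_mkseq.
    - by move=> p p' pp' p'i; rewrite !nth_mkseq; lia.
    - by move=> p pi; rewrite nth_mkseq; lia.
    - by rewrite nth_mkseq.
    - by move=> m; rewrite nolow.
    - move=> m _ p pi pm; rewrite nth_mkseq; last by lia.
      by case: (e_window m) => _ _ /(_ p pm)/andP[].
  have [m lm mmax] := @arg_maxnP _ m0 low (fun m : 'I_l.+1 => m : nat) lm0.
  have /andP[im mj] := lm; exists (e m); split; [split=> // | split=> //].
  - by move=> p p' pp' p'i; apply: e_sorted => //; apply: leq_ltn_trans im.
  - move=> p pi; case: (e_window m) => _ _; apply.
    exact: leq_ltn_trans im.
  - exact: ltW.
  - move=> m' lm' p pi; case: (e_le (mmax m' lm')) => _; apply.
    exact: ltn_trans im.
  - move=> m' um' p pi pm'; case: (e_le (ltnW (lowup _ _ lm um'))) => _.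
    exact.
have [B [[Bs Bsort Bwin Bj] [BL BU]]] : exists B : seq int,
    [/\ (size B <= n.+1)%N,
        forall p p', (p < p')%N -> (p' < size B)%N -> B`_p < B`_p',
        forall p, (p < size B)%N -> M + p%:Z <= B`_p <= N' + p%:Z
      & (i < size B)%N -> j < B`_i] /\
    (forall m, low m -> pure_le (e m) B) /\
    (forall m, ~~ low m -> pure_le B (e m)).
  have [m0 um0|noup] := pickP (fun m => ~~ low m); last first.
    exists [::]; split; [by split | split=> // m].
    by have := noup m; rewrite /= => ->.
  have [m um mmin] := @arg_minnP _ m0 (fun m => ~~ low m)
    (fun m : 'I_l.+1 => m : nat) um0.
  case: (e_window m) => -[_ ms] ml mw; exists (e m); split;
    [split=> // | split].
  - exact: upP.
  - by move=> m' lm'; apply/e_le/ltnW/lowup.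
  - by move=> m' um'; apply/e_le/mmin.
pose f := take i A ++ j :: drop i.+1 B.
have iA' := ltnW iA.
have fsz : size f = maxn i.+1 (size B).
  by rewrite size_cat size_takel //= size_drop; lia.
have fn p : f`_p = if (p < i)%N then A`_p else if p == i then j else B`_p.
  rewrite nth_splice //; case: ltngtP => // [ip|->]; last by rewrite subnn.
  by rewrite -[(p - i)%N]prednK ?subn_gt0 //= nth_drop; congr nth; lia.
have [||m fm] := @comparable_member f.
- split; [split| |].
  + by rewrite fsz; lia.
  + move=> p p' pp'; rewrite fsz !fn => p's.
    case: (ltngtP p' i) => p'i.
    * by rewrite (ltn_trans pp' p'i); apply: Asort => //; apply: ltnW.
    * have p'B : (p' < size B)%N by lia.
      case: (ltngtP p i) => pi.
      - apply: lt_le_trans (Asort p i pi (leqnn i)) _.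
        apply: (le_trans Aj); apply: ltW; apply: (lt_trans (Bj _));
          first by lia.
        exact: Bsort.
      - exact: Bsort.
      - by apply: (lt_trans (Bj _)); [lia | apply: Bsort => //; rewrite -pi].
    * rewrite -p'i pp'; apply: lt_le_trans Aj; rewrite -p'i.
      by apply: Asort; rewrite // p'i.
  + by rewrite fsz; lia.
  + move=> p; rewrite fsz fn => ps; case: (ltngtP p i) => pi.
    * exact/Awin/ltnW.
    * by apply: Bwin; lia.
    * by rewrite pi Mj jN.
- move=> m; have [lm|um] := boolP (low m); [left | right].
    have [sBm Bm] := BL m lm; have /andP[im mj] := lm.
    split=> [|p]; first by rewrite fsz; lia.
    rewrite fsz fn => ps; case: (ltngtP p i) => pi.
    * exact: AL.
    * by apply: Bm; lia.
    * by rewrite pi ltW.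
  have [smB Bm] := BU m um; split=> [|p pm]; first by rewrite fsz; lia.
  rewrite fn; case: (ltngtP p i) => pi.
  * exact: AU.
  * exact: Bm.
  * by rewrite ltW // pi; apply: upP => //; rewrite -pi.
apply: nocov; exists m; rewrite /covers -fm fsz fn ltnn eqxx eqxx.
by rewrite leq_max ltnSn.
Qed.

(** The empty sequence stands for a top element after the last member, the
    degree sequence with all entries infinite. *)
Definition next_member (m : 'I_l.+1) : seq int :=
  if insub m.+1 is Some m' then e m' else [::].

Lemma next_member_le m : pure_le (e m) (next_member m).
Proof.
rewrite /next_member; case: insubP => [m' _ m'E|_] //.
by apply: e_le; rewrite m'E.
Qed.

Lemma next_member_le_later (m m' : 'I_l.+1) : (m < m')%N -> pure_le
  (next_member m) (e m').
Proof.
move=> mm'; rewrite /next_member; case: insubP => [m'' _ m''E|].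
  by apply: e_le; rewrite m''E.
by rewrite (leq_ltn_trans mm') // ltn_ord.
Qed.

(** Two positions left in the same step could be left one after the other,
    through a degree sequence missing from the chain. *)
Lemma one_position_lost m i1 i2 : (i1 < i2)%N -> (i2 < size (e m))%N ->
  covers (next_member m) i1 (e m)`_i1 \/ covers (next_member m) i2 (e m)`_i2.
Proof.
move=> i12 i2A; set A := e m; set B := next_member m.
have [//|c1] := boolP (covers B i1 A`_i1); first by left.
have [//|c2] := boolP (covers B i2 A`_i2); first by right.
have [sAB AB] : pure_le A B := next_member_le m.
have Bsort p p' : (p < p')%N -> (p' < size B)%N -> B`_p < B`_p'.
  rewrite /B /next_member; case: insubP => [m' _ _|_] //; exact: e_sorted.
have Bwin p : (p < size B)%N -> M + p%:Z <= B`_p <= N' + p%:Z.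
  rewrite /B /next_member; case: insubP => [m' _ _|_] //.
  by have [_ _] := e_window m'; apply.
have [[_ Asort] As Awin] := e_window m; rewrite -/A in Asort As Awin.
pose f := take i2 A ++ drop i2 B.
have fsz : size f = maxn i2 (size B).
  by rewrite size_cat size_takel ?size_drop ?(ltnW i2A) //; lia.
have fn p : f`_p = if (p < i2)%N then A`_p else B`_p.
  rewrite nth_splice ?(ltnW i2A) //; case: ltnP => // i2p.
  by rewrite nth_drop subnKC.
have Af : pure_le A f.
  split=> [|p]; first by rewrite fsz geq_max sAB (ltnW i2A).
  by rewrite fsz fn => ps; case: ltnP => // i2p; apply: AB; lia.
have fB : pure_le f B.
  split=> [|p pB]; first by rewrite fsz leq_maxr.
  by rewrite fn; case: ltnP => // pi2; apply: AB.
have A2 : (i2 < size B)%N -> A`_i2 < B`_i2.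
  move=> i2B; rewrite lt_neqAle AB // andbT.
  by move: c2; rewrite /covers i2B.
have [||m' fm'] := @comparable_member f.
- split; [split| |].
  + by rewrite fsz leq_max (leq_ltn_trans _ i12).
  + move=> p p' pp'; rewrite fsz !fn => p's; case: (ltnP p' i2) => p'i.
      by rewrite (ltn_trans pp' p'i); apply: Asort => //; apply: ltn_trans i2A.
    have p'B : (p' < size B)%N by lia.
    case: (ltnP p i2) => pi; last exact: Bsort.
    apply: (lt_trans (Asort p i2 pi i2A)).
    apply: (lt_le_trans (A2 (leq_ltn_trans p'i p'B))).
    move: p'i; rewrite leq_eqVlt => /predU1P[->//|p'i].
    exact/ltW/Bsort.
  + rewrite fsz geq_max (leq_trans sAB As) andbT.
    exact: leq_trans (ltnW i2A) As.
  + move=> p; rewrite fsz fn => ps; case: ltnP => pi.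
      by apply: Awin; apply: ltn_trans i2A.
    by apply: Bwin; lia.
- move=> m'; have [mm'|m'm] := ltnP m m'.
    by right; apply: pure_le_trans fB _; apply: next_member_le_later.
  by left; apply: pure_le_trans Af; apply: e_le.
have [mm'|m'm] := ltnP m m'.
  (* [f] would be the next member, but it still covers the position [i1]. *)
  have fBE : f = B.
    apply: pure_le_anti fB _; rewrite fm'; exact: next_member_le_later.
  move: c1; rewrite /covers -fBE fsz fn i12 eqxx andbT leq_max i12.
  by [].
(* [f] would be [A], but it no longer covers the position [i2]. *)
have fAE : f = A by apply: pure_le_anti _ Af; rewrite fm'; apply: e_le.
have : covers f i2 A`_i2 by rewrite fAE /covers i2A eqxx.
rewrite /covers fsz fn ltnn leq_max ltnn /= => /andP[i2B /eqP AB2].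
by move: (A2 i2B); rewrite AB2 ltxx.
Qed.

Definition unit_diagram (p : nat) (q : int) : diagram :=
  fun i j => ((i == p) && (j == q))%:R.

Definition chain_span (B : diagram) : Prop :=
  exists c, boij_soderberg_decomposition e c B.

Lemma chain_spanD B B' : chain_span B -> chain_span B' ->
  chain_span (fun i j => B i j + B' i j).
Proof.
move=> [c cB] [c' cB']; exists (fun m => c m + c' m) => i j.
by rewrite cB cB' -big_split; apply: eq_bigr => m _; rewrite mulrDl.
Qed.

Lemma chain_spanZ x B : chain_span B -> chain_span (fun i j => x * B i j).
Proof.
move=> [c cB]; exists (fun m => x * c m) => i j.
by rewrite cB mulr_sumr; apply: eq_bigr => m _; rewrite mulrA.
Qed.

Lemma chain_span_ext B B' : (forall i j, B i j = B' i j) ->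
  chain_span B -> chain_span B'.
Proof. by move=> BB' [c cB]; exists c => i j; rewrite -BB'. Qed.

Lemma chain_span_sum (T : Type) (s : seq T) (P : pred T) (B : T -> diagram) :
  (forall t, P t -> chain_span (B t)) ->
  chain_span (fun i j => \sum_(t <- s | P t) B t i j).
Proof.
move=> BP; elim: s => [|t s ih].
  exists (fun=> 0) => i j; rewrite big_nil big1 // => m _.
  by rewrite mul0r.
have [Pt|Pt] := boolP (P t).
  apply: chain_span_ext (chain_spanD (BP t Pt) ih) => i j.
  by rewrite big_cons Pt.
by apply: chain_span_ext ih => i j; rewrite big_cons (negbTE Pt).
Qed.

Lemma chain_span_member m : chain_span (pure_diagram (e m)).
Proof.
exists (fun m' => (m' == m)%:R) => i j.
rewrite (bigD1 m) //= eqxx mul1r big1 ?addr0 // => m' /negbTE ->.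
by rewrite mul0r.
Qed.

Lemma pure_diagram_sum d i j : pure_diagram d i j
  = \sum_(p < size d) pure_diagram d p d`_p * unit_diagram p d`_p i j.
Proof.
rewrite /unit_diagram; have [id|id] := ltnP i (size d).
  rewrite (bigD1 (Ordinal id)) //= eqxx big1 ?addr0 => [|p ne].
    have [->|ne] := eqVneq j d`_i; rewrite /= ?mulr1 //.
    by rewrite mulr0 /pure_diagram (negbTE ne) andbF.
  case: eqP => [ip|_]; last by rewrite mulr0.
  by case/eqP: ne; apply: val_inj.
rewrite big1 => [|p _]; first by rewrite /pure_diagram ltnNge id.
case: eqP => [ip|_]; last by rewrite mulr0.
by have := ltn_ord p; rewrite -ip ltnNge id.
Qed.

(** Descending induction along the chain: among the positions of a member, all
    but the one lost in the next step belong to a later member. *)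
Lemma covered_in_span k (m : 'I_l.+1) i j : (l.+1 - k <= m)%N ->
  covers (e m) i j -> chain_span (unit_diagram i j).
Proof.
elim: k m i j => [|k ih] m i j; first by have := ltn_ord m; lia.
have [km|mk] := leqP (l.+1 - k) m; first by move=> _; apply: ih.
move=> mk' /andP[im /eqP jE].
have next_in p : covers (next_member m) p (e m)`_p ->
    chain_span (unit_diagram p (e m)`_p).
  rewrite /next_member; case: insubP => [m' _ m'E|] //; apply: ih.
  by rewrite m'E; lia.
have [|lost] := boolP (covers (next_member m) i (e m)`_i).
  by rewrite jE; apply: next_in.
have others (p : 'I_(size (e m))) : p != i :> nat ->
    chain_span (unit_diagram p (e m)`_p).
  rewrite neq_ltn => /orP[pi|ip]; apply: next_in.
    by case: (one_position_lost pi im) => //; rewrite (negbTE lost).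
  by case: (one_position_lost ip (ltn_ord p)) => //; rewrite (negbTE lost).
have pnz : pure_diagram (e m) i (e m)`_i != 0.
  rewrite pure_diagram_neq0 ?im ?eqxx //.
  by case: (e_window m).
set x := pure_diagram (e m) i (e m)`_i in pnz.
have rest : chain_span (fun i' j' => \sum_(p < size (e m) | p != i :> nat)
    pure_diagram (e m) p (e m)`_p * unit_diagram p (e m)`_p i' j').
  by apply: chain_span_sum => p /others; apply: chain_spanZ.
have := chain_spanZ x^-1 (chain_spanD (chain_span_member m)
  (chain_spanZ (-1) rest)).
apply: chain_span_ext => i' j'; rewrite {1}pure_diagram_sum.
rewrite (bigD1 (Ordinal im)) //= mulN1r.
rewrite (eq_bigl (fun p : 'I_(size (e m)) => p != Ordinal im)) // addrK.
by rewrite mulKf // jE.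
Qed.

Theorem unit_diagram_in_span i j : (i <= n)%N ->
  M + i%:Z <= j <= N' + i%:Z -> chain_span (unit_diagram i j).
Proof.
move=> iN jw; have [m cov] := position_covered iN jw.
by apply: (@covered_in_span l.+1 m); rewrite ?subnn.
Qed.

End MaximalChain.

(** * Translated families *)

Lemma pure_diagram_translate (s : int) d i j :
  pure_diagram [seq x + s | x <- d] i j = pure_diagram d i (j - s).
Proof.
rewrite /pure_diagram size_map; have [id|//] := ltnP i (size d).
rewrite (nth_map 0) // subr_eq; case: eqP => // _ /=.
apply: eq_bigr => p _; rewrite (nth_map 0) //.
by congr ((`| _ |%:~R)^-1); ring.
Qed.

(** The first entry of a translate by [a * k + b] lies between [r * k] and
    [r * k + N] for all [k], so the slope [a] is [r]. *)
Lemma translated_pure_slope n (r N : nat) (d : nat -> seq int) :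
  translated_pure d ->
  (forall k, pure_in_window n (r * k)%N%:Z (r * k + N)%N%:Z (d k)) ->
  forall k, d k = [seq x + (r * k)%N%:Z | x <- d 0%N].
Proof.
move=> [d0 [a [b [[sd _] dE]]]] win.
have bound k : (r * k)%N%:Z <= d0`_0 + (a * k%:Z + b) <= (r * k + N)%N%:Z.
  have [_ _ /(_ 0%N)] := win k.
  by rewrite dE size_map (nth_map 0) // !addr0; apply.
have ar : a = r%:Z.
  have := bound 0%N; have := bound N.+1; rewrite !PoszD !PoszM.
  move: (d0`_0) => x; nia.
move=> k; rewrite !dE -map_comp; apply: eq_map => x /=.
by rewrite ar PoszM mulr0 add0r; ring.
Qed.

Theorem theorem3p2 (F : fieldType) (charF0 : [pchar F] =i pred0) (n r : nat)
    (I : {mpoly F[n]} -> Prop) (genI : generated_in_degree r I) (N : nat)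
    (windowN : exists k0 : nat, forall k : nat, (k0 < k)%N ->
       in_window n (r * k)%N%:Z (r * k + N)%N%:Z
         (betti_diagram (ideal_exp I k))) :
  exists K : nat,
    forall (l : nat) (d : 'I_l.+1 -> nat -> seq int),
      translated_maximal_chains n r N d ->
      exists w : 'I_l.+1 -> {poly rat},
        forall k : nat, (K < k)%N ->
          boij_soderberg_decomposition (fun m => d m k)
            (fun m => (w m).[k%:R]) (betti_diagram (ideal_exp I k)).
Proof.
have [gs [gs_homog Igs]] := genI; have [k0 window] := windowN.
pose T := ('I_n.+1 * 'I_N.+1)%type.
pose pos (t : T) : int := t.1%:Z + t.2%:Z.
pose entry (t : T) k : rat := betti_diagram (ideal_exp I k) t.1 ((r * k)%N%:Z
  + pos t).
have [P PP] : exists P : T -> {poly rat}, forall t, exists Kt, forall k,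
    (Kt <= k)%N -> entry t k = (P t).[k%:R].
  apply: (@fin_all_exists _ _ (fun t Q => exists Kt, forall k,
    (Kt <= k)%N -> entry t k = Q.[k%:R])) => t.
  have [Q [Kt QK]] :=
    betti_eventually_polynomial gs_homog Igs charF0 t.1 (pos t).
  by exists Q, Kt.
have [Kt KtP] : exists Kt : T -> nat, forall t k,
    (Kt t <= k)%N -> entry t k = (P t).[k%:R].
  exact: (@fin_all_exists _ _ (fun t x => forall k,
    (x <= k)%N -> entry t k = (P t).[k%:R])).
exists (maxn k0 (\max_t Kt t)) => l d [dtr dmax].
have dwin m k : pure_in_window n (r * k)%N%:Z (r * k + N)%N%:Z (d m k).
  by have [_ [[win _] _]] := dmax k; apply: win; exists m.
have dE m k : d m k = [seq x + (r * k)%N%:Z | x <- d m 0%N].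
  by apply: translated_pure_slope (dtr m) _ k => k'; apply: dwin.
have [lt0 max0] := dmax 0%N.
(* Unit diagrams are expressed in the chain at [k = 0], which determines all
   others by translation. *)
have [c cP] : exists c : T -> 'I_l.+1 -> rat, forall t,
    boij_soderberg_decomposition (fun m => d m 0%N) (c t)
      (unit_diagram t.1 (pos t)).
  apply: (@fin_all_exists T (fun=> 'I_l.+1 -> rat)
    (fun t x => boij_soderberg_decomposition
    (fun m => d m 0%N) x (unit_diagram t.1 (pos t)))) => t.
  apply: (unit_diagram_in_span lt0 max0); first by rewrite -ltnS.
  case: t => t1 t2; rewrite /pos muln0 /=; have := ltn_ord t2.
  by move=> ?; apply/andP; split; lia.
exists (fun m => \sum_t c t m *: P t) => k;
  rewrite gtn_max => /andP[k0k Kk] i j.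
have -> : betti_diagram (ideal_exp I k) i j
    = \sum_t (P t).[k%:R] * unit_diagram t.1 (pos t) i (j - (r * k)%N%:Z).
  have [B0|/(window k k0k i j)[iN /andP[jl jr]]] :=
      eqVneq (betti_diagram (ideal_exp I k) i j) 0.
    rewrite B0 big1 // => t _; rewrite /unit_diagram.
    have [it|_] := eqVneq i (t.1 : nat); last by rewrite mulr0.
    have [jt|_] := eqVneq (j - (r * k)%N%:Z) (pos t); last by rewrite mulr0.
    rewrite -KtP; last by apply: leq_trans (ltnW Kk); apply: leq_bigmax.
    by rewrite /entry -it -jt addrC subrK B0 mul0r.
  have i_lt : (i < n.+1)%N by [].
  have j_lt : (absz (j - (r * k)%N%:Z - i%:Z)%R < N.+1)%N by lia.
  pose t0 : T := (Ordinal i_lt, Ordinal j_lt).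
  have jE : j - (r * k)%N%:Z = pos t0 by rewrite /pos /=; lia.
  rewrite (bigD1 t0) //= big1 ?addr0 => [|t ne].
    rewrite /unit_diagram jE !eqxx mulr1 -KtP; last first.
      by apply: leq_trans (ltnW Kk); apply: leq_bigmax.
    by rewrite /entry -jE addrC subrK.
  rewrite /unit_diagram; case: eqP => [it|_]; last by rewrite mulr0.
  case: eqP => [jt|_]; last by rewrite mulr0.
  case/eqP: ne; case: t it jt => t1 t2 /= it.
  rewrite jE /pos /= -it => /addrI[t2E].
  by congr pair; apply: val_inj.
under eq_bigr do rewrite (cP _ i (j - (r * k)%N%:Z)) mulr_sumr.
rewrite exchange_big; apply: eq_bigr => m _.
rewrite horner_sum mulr_suml (dE m k) pure_diagram_translate;
  apply: eq_bigr => t _.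
by rewrite hornerZ mulrCA mulrA.
Qed.
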